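(* For all sufficiently large $n$, $$0.596400\, n^2 < t(K_n) < 0.637152\, n^2,$$ where $K_n$ is the complete graph on $n$ vertices and $t(\cdot)$ denotes the toppling number.
   Context: All graphs are finite, simple and undirected. A configuration of a graph $G$ is a function $c: V(G)\to \mathbb{N}\cup\{0\}$ giving the number of chips on each vertex. A vertex $v$ may be fired if $c(v)\ge \deg(v)$; firing $v$ removes $\deg(v)$ chips from $v$ and adds one chip to each neighbour of $v$. A configuration is volatile if there is an infinite sequence $v_1,v_2,\dots$ of vertices that may be fired in that order. The toppling game on $G$: initially there are no chips; two players, Max and Min, alternately place one chip on a vertex of their choice (Max moves first). After each move vertices are fired as possible, and the game ends as soon as a volatile configuration is reached. Max aims to maximize and Min to minimize the number of chips placed during the game. The toppling number $t(G)$ is the length (number of chips placed) of the game when Max starts and both play optimally. *)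

(* Defs.v *)
From mathcomp Require Import all_boot.
From mathcomp Require Import boolp classical_sets.

Set Implicit Arguments.
Unset Strict Implicit.
Unset Printing Implicit Defensive.

Record sgraph := SGraph {
  vertex :> finType;
  adj : rel vertex;
  adj_sym : symmetric adj;
  adj_irrefl : irreflexive adj
}.

Section ChipFiring.
Variable G : sgraph.

Definition config := {ffun G -> nat}.

Implicit Types (c d : config) (v w : G).

Definition deg v : nat := #|[set w | adj v w]|.

Definition firable c v : bool := deg v <= c v.

Definition fire c v : config :=
  [ffun w => if w == v then c w - deg v else c w + adj v w].

Definition stable c : Prop := forall v, ~~ firable c v.

Inductive topples : config -> config -> Prop :=
| topples_refl c : topples c c
| topples_step c v d : firable c v -> topples (fire c v) d -> topples c d.

Fixpoint fire_first c (s : nat -> G) (i : nat) : config :=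
  if i is j.+1 then fire (fire_first c s j) (s j) else c.

Definition volatile c : Prop :=
  exists s : nat -> G, forall i, firable (fire_first c s i) (s i).

Definition add_chip c v : config := [ffun w => c w + (w == v)].

Definition empty_config : config := [ffun=> 0].

(* The position left by a move: play stops at once on a volatile
   configuration, and otherwise vertices are fired until none can be. *)
Definition settles c d : Prop :=
  (volatile c /\ d = c) \/ [/\ ~ volatile c, topples c d & stable d].

Inductive player := Max | Min.

Definition opponent (p : player) : player :=
  match p with Max => Min | Min => Max end.

Definition prefers (p : player) (m k : nat) : bool :=
  match p with Max => k <= m | Min => m <= k end.

(* [optimal_length p c k]: when [p] is to move in position [c] and both
   players play optimally, exactly [k] further chips are placed.  Here [next v]
   is the position reached by playing on [v], [len v] is the length of optimal
   play from there, and [best] is an optimal move. *)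
Inductive optimal_length : player -> config -> nat -> Prop :=
| game_over p c : volatile c -> optimal_length p c 0
| one_move p c (next : G -> config) (len : G -> nat) (best : G) :
    ~ volatile c ->
    (forall v, settles (add_chip c v) (next v)) ->
    (forall v, optimal_length (opponent p) (next v) (len v)) ->
    (forall v, prefers p (len best) (len v)) ->
    optimal_length p c (len best).+1.

(* The value [k] below exists and is unique when [G] has a vertex: see
   [toppling_numberP] and [optimal_length_uniq]. *)
Definition toppling_number : nat :=
  xget 0 [set k | optimal_length Max empty_config k]%classic.

Lemma fireC c v w : v != w -> firable c v -> firable c w ->
  fire (fire c v) w = fire (fire c w) v.
Proof.
move=> vw; rewrite /firable => cv cw; apply/ffunP => x; rewrite !ffunE.
case: (eqVneq x w) => [->|xw]; first by rewrite eq_sym (negbTE vw) addnBAC.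
by case: (eqVneq x v) => [->|xv]; [rewrite addnBAC|rewrite addnAC].
Qed.

Lemma firable_fire c v w : v != w -> firable c w -> firable (fire c v) w.
Proof.
move=> vw; rewrite /firable ffunE eq_sym (negbTE vw) => cw.
exact: leq_trans cw (leq_addr _ _).
Qed.

Lemma topples_fire c d v :
  topples c d -> stable d -> firable c v -> topples (fire c v) d.
Proof.
move=> cd; elim: cd v => {c d} [c v /(_ v) /negP //|c w d cw wd IH v dS cv].
case: (eqVneq v w) => [->//|vw].
apply: (@topples_step _ w); first exact: firable_fire.
rewrite fireC //; apply: IH => //; apply: firable_fire => //.
by rewrite eq_sym.
Qed.

Lemma topples_stable c d d' :
  topples c d -> stable d -> topples c d' -> stable d' -> d = d'.
Proof.
move=> cd dS cd' d'S; elim: cd' cd d'S => {c d'} [c cd cS|c v d' cv _ IH cd].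
  by case: cd cS => // c0 v d0 cv _ /(_ v); rewrite cv.
by apply: IH; exact: topples_fire.
Qed.

Lemma settles_uniq c d d' : settles c d -> settles c d' -> d = d'.
Proof.
case=> [[cV ->]|[cV cd dS]] [[cV' ->]|[cV' cd' d'S]] //.
exact: topples_stable cd dS cd' d'S.
Qed.

Lemma settles_ex c : exists d, settles c d.
Proof.
case: (pselect (volatile c)) => cV; first by exists c; left.
apply: contrapT => noS; apply: cV.
have step d : topples c d -> exists v, firable d v.
  move=> cd; apply: contrapT => dS; apply: (noS); exists d; right; split => //.
    by move=> cV; apply: (noS); exists c; left.
  by move=> v; apply/negP => dv; apply: dS; exists v.
have topples_rcons d v : topples c d -> firable d v -> topples c (fire d v).
  elim=> {d}[d|d w d' dw _ IH] dv; apply: topples_step; 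
    [exact: dv|exact: topples_refl|exact: dw|exact: IH].
have [v0 _] := step c (topples_refl c).
pose next d := xget v0 [set v | firable d v]%classic.
have nextP d : topples c d -> firable d (next d).
  by move=> /step [v dv]; exact: (@xgetI _ v0 [set v | firable d v]%classic v).
pose D i := iter i (fun d => fire d (next d)) c.
exists (fun i => next (D i)).
have DE i : fire_first c (fun i => next (D i)) i = D i.
  by elim: i => //= i ->.
have cD i : topples c (D i).
  elim: i => [|i IH]; first exact: topples_refl.
  by apply: topples_rcons => //; exact: nextP.
by move=> i; rewrite DE; exact: nextP.
Qed.

Lemma optimal_length_uniq p c k k' :
  optimal_length p c k -> optimal_length p c k' -> k = k'.
Proof.
move=> H; elim: H k' => {p c k}
  [p c cV k' H|p c next len b cV nextP _ IH bP k' H].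
  by case: H cV.
case: p c k' / H cV nextP IH bP => //.
move=> p c next' len' b' _ next'P lenP b'P _ nextP IH bP.
have E v : len v = len' v.
  by apply: IH; rewrite (settles_uniq (nextP v) (next'P v)); exact: lenP.
have := bP b'; have := b'P b; rewrite !E => {IH lenP bP b'P}.
by case: p => /= h1 h2; congr S; apply/eqP; rewrite eqn_leq h1 h2.
Qed.

Definition chips c : nat := \sum_v c v.

Lemma chips_fire c v : firable c v -> chips (fire c v) = chips c.
Proof.
rewrite /chips /firable => cv.
rewrite (bigD1 v) //= [RHS](bigD1 v) //= ffunE eqxx.
under eq_bigr => w /negbTE wv do rewrite ffunE wv.
have degE : deg v = \sum_(w | w != v) adj v w.
  rewrite /deg -sum1_card big_mkcond (bigD1 v) //= inE adj_irrefl add0n.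
  by apply: eq_bigr => w _; rewrite inE; case: adj.
by rewrite big_split /= -degE addnCA subnK // addnC.
Qed.

Lemma chips_add c v : chips (add_chip c v) = (chips c).+1.
Proof.
rewrite /chips; under eq_bigr do rewrite ffunE.
rewrite big_split /= -addn1; congr addn.
by rewrite (bigD1 v) //= eqxx big1 // => w /negbTE ->.
Qed.

Lemma chips_topples c d : topples c d -> chips d = chips c.
Proof. by elim=> // {}c v {}d cv _ ->; exact: chips_fire. Qed.

Lemma optimal_length_ex p c (v0 : G) : exists k, optimal_length p c k.
Proof.
pose B := \sum_v deg v.
suff Hs m : forall p c, stable c \/ volatile c -> B - chips c <= m ->
    exists k, optimal_length p c k.
  have [next nextP] := choice (fun v => settles_ex (add_chip c v)).
  case: (pselect (volatile c)) => cV; first by exists 0; constructor.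
  have nextS v : stable (next v) \/ volatile (next v).
    by case: (nextP v) => [[V ->]|[_ _ ?]]; [right|left].
  have [len lenP] := choice (fun v => Hs _ (opponent p) _ (nextS v) (leqnn _)).
  have [b bP] : exists b, forall v, prefers p (len b) (len v).
    case: p {lenP} => /=.
      by case: (@arg_maxnP _ v0 predT len) => // b _ H; exists b => v; exact: H.
    by case: (@arg_minnP _ v0 predT len) => // b _ H; exists b => v; exact: H.
  by exists (len b).+1; apply: one_move bP.
elim: m => [|m IH] {}p {}c cS cB;
  (case: (pselect (volatile c)) => cV; first by exists 0; constructor);
  case: cS => // cS.
  suff : chips c < B by rewrite -subn_gt0 ltnNge cB.
  rewrite /chips /B (bigD1 v0) //= [X in _ < X](bigD1 v0) //= -addSn.
  by apply: leq_add; [|apply: leq_sum => w _; apply: ltnW];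
    rewrite ltnNge; exact: cS.
have [next nextP] := choice (fun v => settles_ex (add_chip c v)).
have nextS v : stable (next v) \/ volatile (next v).
  by case: (nextP v) => [[V ->]|[_ _ ?]]; [right|left].
have nextB v : B - chips (next v) <= m.
  have -> : chips (next v) = (chips c).+1.
    rewrite -(chips_add c v).
    by case: (nextP v) => [[_ ->//]|[_ /chips_topples]].
  by rewrite subnS -ltnS; case: (B - chips c) cB.
have [len lenP] := choice (fun v => IH (opponent p) _ (nextS v) (nextB v)).
have [b bP] : exists b, forall v, prefers p (len b) (len v).
  case: p {lenP} => /=.
    by case: (@arg_maxnP _ v0 predT len) => // b _ H; exists b => v; exact: H.
  by case: (@arg_minnP _ v0 predT len) => // b _ H; exists b => v; exact: H.
by exists (len b).+1; apply: one_move bP.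
Qed.

Lemma toppling_numberP (v0 : G) :
  optimal_length Max empty_config toppling_number.
Proof.
have [k kP] := optimal_length_ex Max empty_config v0.
by apply: xgetPex; exists k.
Qed.

End ChipFiring.

Definition complete_adj (n : nat) : rel 'I_n := fun x y => x != y.

Lemma complete_adj_sym n : symmetric (@complete_adj n).
Proof. by move=> x y; rewrite /complete_adj eq_sym. Qed.

Lemma complete_adj_irrefl n : irreflexive (@complete_adj n).
Proof. by move=> x; rewrite /complete_adj eqxx. Qed.

Definition complete_graph (n : nat) : sgraph :=
  SGraph (@complete_adj_sym n) (@complete_adj_irrefl n).

(* Main.v *)
Require Import Defs.
From Stdlib Require Import Reals.
From Stdlib Require Ranalysis5 Lra Psatz.
From mathcomp Require all_boot boolp classical_sets zify.
From Coquelicot Require Coquelicot.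

(* A configuration of [K_n] is encoded by an [n]-periodic integer profile [a]
   with [a (i + 1) <= a i + 1].  Firing rotates the profile, a chip raises one
   entry [a j] with [a j <= a (j - 1)], and the configuration is volatile iff all
   entries are at least [n].  With [deficit] and [surplus] the total amounts by
   which the entries fall below or exceed [n], the number of chips is
   [n (n - 1) / 2 - deficit + surplus], so the game is about the final surplus.

   Lower bound: Max builds a run on which [a] climbs as [n, ..., n + l - 1],
   extending it at its cheaper end, and repays each chip Min places with one of
   his own.  If both ends are expensive, then the deficit is large; this bounds
   the price of an extension.  Upper bound: Min always raises a minimum of the
   profile, which keeps the deficit wide and shallow, so that Max gains surplus
   only slowly.  In both cases the rescaled state follows a curve given by an
   explicitly solvable differential equation: the lower one runs through a
   logarithmic arc and then along a logarithmic spiral.  The two constants are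
   [1/2 + L^2/2] for [L] the length of the curve. *)


(** * The two limiting curves: explicit solutions and numerical constants *)

Module Curves.
Import Ranalysis5 Lra Psatz Coquelicot.Coquelicot.
Local Open Scope R_scope.

Lemma decr_of_derive (f f' : R -> R) (a b : R) : a <= b ->
  (forall t, a <= t <= b -> is_derive f t (f' t)) ->
  (forall t, a <= t <= b -> f' t <= 0) -> f b <= f a.
Proof.
intros ab fd fneg; destruct (Rle_lt_or_eq_dec a b ab) as [lt|<-]; [|lra].
destruct (MVT_cor2 f f' a b lt) as [t [e ht]].
  intros t ht; apply is_derive_Reals; auto.
assert (f' t <= 0) by (apply fneg; lra); nra.
Qed.

Lemma ivt_derive (f f' : R -> R) (a b y : R) : a <= b ->
  (forall t, a <= t <= b -> is_derive f t (f' t)) ->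
  f a <= y <= f b -> {t | a <= t <= b /\ f t = y}.
Proof.
intros ab fd [[la|ea]%Rle_lt_or_eq_dec [lb|eb]%Rle_lt_or_eq_dec];
  [|exists b; split; lra|exists a; split; lra|exists a; split; lra].
destruct (Rle_lt_or_eq_dec a b ab) as [lt|e]; [|exfalso; rewrite e in la; lra].
destruct (IVT_interv (fun t => f t - y) a b) as [t [ht e]]; try lra.
  intros t ht; apply continuity_pt_minus.
    apply derivable_continuous_pt; exists (f' t); apply is_derive_Reals; auto.
  apply continuity_pt_const; now intros u v.
exists t; split; lra.
Qed.

Lemma exp_ge_poly (x : R) : 0 <= x ->
  1 + x * (1 + x / 2 * (1 + x / 3 * (1 + x / 4 * (1 + x / 5 *
    (1 + x / 6 * (1 + x / 7 * (1 + x / 8))))))) <= exp x.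
Proof.
intros x0; apply Rle_trans with (2 := exp_ge_taylor x 8 x0).
assert (F : forall k, INR (Factorial.fact (S k)) = INR (S k) * INR (Factorial.fact k)).
  intros k; change (Factorial.fact (S k)) with (S k * Factorial.fact k)%nat.
  rewrite mult_INR; reflexivity.
cbn [sum_f_R0]; rewrite !F; change (INR (Factorial.fact 0)) with 1; simpl INR.
apply Req_le; field.
Qed.

(* [1 / (2 L - 1) < exp (2 L + 2)] at [L = 0.52374]. *)
Lemma end_ln : - ln (2 * 0.52374 - 1) < 2 * 0.52374 + 2.
Proof.
rewrite <- ln_Rinv by lra; rewrite <- (ln_exp (2 * _ + _)).
apply ln_increasing; [apply Rinv_0_lt_compat; lra|].
replace (2 * 0.52374 + 2) with (0.76187 + 0.76187 + (0.76187 + 0.76187)) by lra.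
rewrite !exp_plus; assert (B := exp_ge_poly 0.76187 ltac:(lra)).
assert (E : 2.142270 <= exp 0.76187) by lra.
assert (2.142270 * 2.142270 <= exp 0.76187 * exp 0.76187) by nra.
apply Rlt_le_trans with ((2.142270 * 2.142270) * (2.142270 * 2.142270)); [lra|nra].
Qed.

(* The upper curve solves [x' = - (1 - u) / (2 u - 1)] for [x = upper_length u],
   with value [zeta] satisfying [zeta' = - 2 c x'] for [c = u - x].  It starts at
   [u = 0.9995] instead of the stationary point [u = 1], which costs
   [0.0005 ^ 2 / 2] in the value, and ends where [c = 0], at [u < 0.52374]. *)
Definition upper_rate (u : R) : R := u / 2 - 1 / 2 - ln (2 * u - 1) / 4.
Definition upper_length (u : R) : R := upper_rate u - upper_rate 0.9995.
Definition upper_value (u : R) : R := 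
  u - u * u / 2 - upper_length u + upper_length u * upper_length u.

Lemma upper_length_derive u : 1 / 2 < u ->
  is_derive upper_length u (- (1 - u) / (2 * u - 1)).
Proof.
intros hu; unfold upper_length, upper_rate; auto_derive; [lra|field; lra].
Qed.

Lemma upper_value_derive u : 1 / 2 < u ->
  is_derive upper_value u
    (- 2 * (u - upper_length u) * (- (1 - u) / (2 * u - 1))).
Proof.
intros hu; assert (D := upper_length_derive u hu).
apply is_derive_ext with (fun t => (t - t * t / 2)
  + (upper_length t * upper_length t - upper_length t)).
  intros t; unfold upper_value; simpl; ring.
evar_last.
  eapply (is_derive_plus (fun t => t - t * t / 2)); [auto_derive; [auto|reflexivity]|].
  eapply (is_derive_minus (fun t => upper_length t * upper_length t)); [|exact D].
  eapply (is_derive_mult _ _ _ _ _ D D); intros; apply Rmult_comm.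
unfold plus, minus, mult; simpl; unfold plus, opp, mult; simpl; field; lra.
Qed.

Lemma upper_length_decr u v : 1 / 2 < u -> u < v -> v < 1 ->
  upper_length v < upper_length u.
Proof.
intros hu uv v1; destruct (MVT_cor2 upper_length
  (fun t => - (1 - t) / (2 * t - 1)) u v uv) as [t [e ht]].
  intros t ht; apply is_derive_Reals, upper_length_derive; lra.
assert (0 < (1 - t) / (2 * t - 1)) by (apply Rdiv_lt_0_compat; lra).
replace (- (1 - t) / (2 * t - 1)) with (- ((1 - t) / (2 * t - 1))) in e by (field; lra).
nra.
Qed.

(** This is the tangent inequality of a convex function: in terms of the length, the value has slope
    [- 2 c] with [c = u - upper_length u], and [c] decreases as the length grows. *)
Lemma upper_value_le u v : 1 / 2 < v -> v <= u -> u < 1 ->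
  upper_value u + 2 * (u - upper_length u) * upper_length u
  <= upper_value v + 2 * (u - upper_length u) * upper_length v.
Proof.
intros hv vu u1; set (k := u - upper_length u).
apply (decr_of_derive (fun t => upper_value t + 2 * k * upper_length t)
  (fun t => 2 * (- (1 - t) / (2 * t - 1)) * (k - (t - upper_length t)))); auto.
  intros t ht; evar_last.
    eapply (is_derive_plus upper_value); [apply upper_value_derive; lra|].
    apply is_derive_scal, upper_length_derive; lra.
  unfold plus; simpl; ring.
intros t ht; assert (upper_length u <= upper_length t).
  destruct (Rle_lt_or_eq_dec t u) as [lt| ->]; try lra.
  apply Rlt_le, upper_length_decr; lra.
assert (0 <= (1 - t) / (2 * t - 1)) by (apply Rdiv_le_0_compat; lra).
replace (- (1 - t) / (2 * t - 1)) with (- ((1 - t) / (2 * t - 1))) by (field; lra).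
unfold k; nra.
Qed.

Lemma upper_curve : exists zeta c : R -> R,
  (forall x y, x <= y -> zeta y <= zeta x) /\
  (forall x y, x <= y -> zeta x - zeta y <= 2 * c x * (y - x)) /\
  (forall x k, 0 <= x -> 0 <= k -> k < c x ->
     (1 - x) * k - k * k / 2 + x * x / 2 <= zeta x) /\
  (forall x, 0 <= c x <= 1) /\
  (forall x, x <= 0 -> c x = c 0 /\ zeta x = zeta 0) /\
  1 / 2 <= zeta 0 /\
  exists L, L * L / 2 <= 0.13715193 /\
    forall x, L <= x -> zeta x <= 0.13715193.
Proof.
assert (pos : forall u, 1 / 2 < u -> 0 <= upper_rate u).
  intros u hu; unfold upper_rate.
  assert (E := exp_ineq1_le (ln (2 * u - 1))); rewrite exp_ln in E; lra.
assert (p1 := pos 0.9995 ltac:(lra)).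
assert (len1 : upper_length 0.9995 = 0) by (unfold upper_length; lra).
assert (len_lo : 0.505 <= upper_length 0.505).
  unfold upper_length, upper_rate.
  assert (E : ln (2 * 0.505 - 1) <= Ropp 4).
    rewrite <- (ln_exp (Ropp 4)); apply ln_le; [lra|].
    rewrite exp_Ropp; replace (2 * 0.505 - 1) with (/ 100) by lra.
    apply Rinv_le_contravar; [apply exp_pos|].
    replace 4 with (1 + 1 + (1 + 1)) by lra; rewrite !exp_plus.
    assert (E := exp_le_3); assert (E' := exp_pos 1).
    assert (exp 1 * exp 1 <= 9) by nra; nra.
  assert (E' : ln (2 * 0.9995 - 1) <= 0) by (rewrite <- ln_1; apply ln_le; lra).
  assert (E'' : - (1 / 100) <= ln (2 * 0.9995 - 1)).
    rewrite <- (ln_exp (- (1 / 100))); apply ln_le; [apply exp_pos|].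
    rewrite exp_Ropp.
    assert (I := exp_ineq1_le (1 / 100)).
    apply Rle_trans with (/ (1 + 1 / 100)); [|lra].
    apply Rinv_le_contravar; lra.
  lra.
assert (len_hi : upper_length 0.52374 <= 0.52374).
  unfold upper_length; assert (E := end_ln); unfold upper_rate at 1; lra.
(* [L] is the end of the curve, where [c = 0]: there [upper_length L = L] and the value is
   [L ^ 2 / 2]. *)
destruct (ivt_derive (fun u => u - upper_length u)
  (fun u => 1 - - (1 - u) / (2 * u - 1)) 0.505 0.52374 0) as [L [hL eL]]; try lra.
  intros t ht; apply (is_derive_minus (fun t => t) upper_length t 1 _ (is_derive_id t)).
  apply upper_length_derive; lra.
(* Clamping to [[0, L]] extends the curve by constants to all real lengths. *)
set (t := fun x => Rmax 0 (Rmin x L)).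
assert (ht : forall x, 0 <= t x <= L).
  intros x; unfold t; split; [apply Rmax_l|apply Rmax_lub; [lra|apply Rmin_r]].
assert (tle : forall x y, x <= y -> t x <= t y <= t x + (y - x)).
  intros x y xy; unfold t, Rmax, Rmin.
  repeat destruct Rle_dec; lra.
assert (tE : forall x, 0 <= x <= L -> t x = x).
  intros x hx; unfold t; rewrite Rmin_left, Rmax_right; lra.
assert (Us : forall x, {u | L <= u <= 0.9995 /\ upper_length u = t x}).
  intros x; destruct (ivt_derive (fun u => - upper_length u)
    (fun u => - (- (1 - u) / (2 * u - 1))) L 0.9995 (- t x)) as [u [hu e]].
  - lra.
  - intros s hs; apply (is_derive_opp upper_length),  upper_length_derive; lra.
  - specialize (ht x); lra.
  - exists u; split; lra.
set (U := fun x => proj1_sig (Us x)).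
assert (hU : forall x, L <= U x <= 0.9995 /\ upper_length (U x) = t x).
  intros x; unfold U; destruct (Us x); auto.
assert (U_mono : forall x y, t x <= t y -> U y <= U x).
  intros x y xy; destruct (hU x) as [hx ex], (hU y) as [hy ey].
  destruct (Rle_lt_dec (U y) (U x)) as [|lt]; auto.
  assert (upper_length (U y) < upper_length (U x)) by (apply upper_length_decr; lra).
  lra.
set (c := fun x => U x - t x).
assert (c0 : forall x, 0 <= c x <= 1).
  intros x; unfold c; destruct (hU x) as [hx ex]; specialize (ht x); split; [|lra].
  enough (t x <= L) by lra; lra.
assert (main : forall x y, x <= y -> upper_value (U x) - upper_value (U y)
    <= 2 * c x * (t y - t x)).
  intros x y xy; destruct (hU x) as [hx ex], (hU y) as [hy ey].
  assert (E := upper_value_le (U x) (U y) ltac:(lra) (U_mono x y (proj1 (tle x y xy))) ltac:(lra)).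
  rewrite ex, ey in E; unfold c; lra.
(* At [u = 0.9995] the value falls short of 1/2 by exactly the constant added here. *)
exists (fun x => upper_value (U x) + 0.0005 * 0.0005 / 2), c.
assert (tneg : forall x, x <= 0 -> t x = t 0).
  intros x x0; unfold t, Rmax, Rmin; repeat destruct Rle_dec; lra.
assert (Uneg : forall x, x <= 0 -> U x = U 0).
  intros x x0; assert (E := tneg x x0); apply Rle_antisym; apply U_mono; lra.
repeat split.
- intros x y xy.
  destruct (hU x) as [hx ex], (hU y) as [hy ey].
  assert (E := decr_of_derive (fun s => - upper_value s) (fun s =>
    - (- 2 * (s - upper_length s) * (- (1 - s) / (2 * s - 1)))) (U y) (U x)
    (U_mono x y (proj1 (tle x y xy)))).
  enough (- upper_value (U x) <= - upper_value (U y)) by lra; apply E.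
    intros s hs; apply (is_derive_opp upper_value), upper_value_derive; lra.
  intros s hs.
  assert (0 <= (1 - s) / (2 * s - 1)) by (apply Rdiv_le_0_compat; lra).
  replace (- (1 - s) / (2 * s - 1)) with (- ((1 - s) / (2 * s - 1))) by (field; lra).
  enough (upper_length s <= s) by nra.
  apply Rle_trans with (upper_length (U y)); [|rewrite ey; destruct (ht y); lra].
  destruct (Rle_lt_or_eq_dec (U y) s) as [lt| <-]; try lra.
  apply Rlt_le, upper_length_decr; lra.
- intros x y xy; assert (E := main x y xy); destruct (tle x y xy), (c0 x); nra.
- intros x k x0 k0 kc.
  assert (xL : x <= L).
    destruct (Rle_lt_dec x L) as [|lt]; auto; exfalso.
    assert (c x <= 0); [|lra].
    destruct (hU x) as [hx ex]; destruct (hU L) as [hL' eL'].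
    assert (t x = L) by (unfold t; rewrite Rmin_right, Rmax_right; lra).
    assert (E := U_mono L x ltac:(rewrite tE; lra)).
    destruct (Rle_lt_or_eq_dec L (U x)) as [lt'|e]; try lra.
      assert (upper_length (U x) < upper_length L) by (apply upper_length_decr; lra); lra.
    unfold c; lra.
  unfold upper_value; destruct (hU x) as [hx ex]; rewrite ex.
  unfold c in kc; rewrite tE in * by lra; nra.
- apply c0.
- apply c0.
- unfold c; rewrite (Uneg x), (tneg x); auto.
- rewrite (Uneg x); auto.
- assert (U 0 = 0.9995).
    destruct (hU 0) as [h e]; rewrite tE in e by lra.
    destruct (Rle_lt_or_eq_dec (U 0) 0.9995) as [lt|]; try lra.
    assert (upper_length 0.9995 < upper_length (U 0)) by (apply upper_length_decr; lra); lra.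
  rewrite H; unfold upper_value; rewrite len1; lra.
- exists L; split; [nra|]; intros x Lx.
  assert (eU : U x = L).
    destruct (hU x) as [h e].
    assert (t x = L) by (unfold t; rewrite Rmin_right, Rmax_right; lra).
    destruct (Rle_lt_or_eq_dec L (U x)) as [lt'|]; try lra.
    assert (upper_length (U x) < upper_length L) by (apply upper_length_decr; lra); lra.
  rewrite eU; unfold upper_value; replace (upper_length L) with L by lra; nra.
Qed.

(** * The curve of the lower bound: logarithmic arc, then spiral *)

Lemma exp_le_poly (x : R) : 0 <= x <= 1 ->
  exp x <= 1 + x * (1 + x / 2 * (1 + x / 3 * (1 + x / 4 * (1 + x / 5 *
    (1 + x / 6 * (1 + x / 7 * (1 + x / 8 * (1 + x / 9 * 2)))))))).
Proof.
(* Doubling the last Taylor coefficient makes [exp (- t) * P t] nondecreasing on [[0, 1]], and it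
   equals 1 at 0. *)
intros x01; set (P := fun x => 1 + x * (1 + x / 2 * (1 + x / 3 * (1 + x / 4 *
  (1 + x / 5 * (1 + x / 6 * (1 + x / 7 * (1 + x / 8 * (1 + x / 9 * 2))))))))).
assert (E := decr_of_derive (fun t => - (exp (- t) * P t))
  (fun t => - (exp (- t) * (t ^ 8 / 40320 * (1 - 2 * t / 9)))) 0 x (proj1 x01)).
enough (1 <= exp (- x) * P x).
  rewrite exp_Ropp in H; fold (P x); apply Rmult_le_reg_l with (/ exp x).
    apply Rinv_0_lt_compat, exp_pos.
  rewrite Rinv_l; auto; apply Rgt_not_eq, exp_pos.
enough (- (exp (- x) * P x) <= - (exp (- 0) * P 0)).
  unfold P at 2 in H; rewrite Ropp_0, exp_0 in H; lra.
apply E.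
  intros t ht; unfold P; auto_derive; auto; field.
intros t ht; assert (0 <= exp (- t)) by apply Rlt_le, exp_pos.
assert (0 <= t ^ 8 / 40320) by (apply Rmult_le_pos; [apply pow_le|]; lra).
assert (0 <= t ^ 8 / 40320 * (1 - 2 * t / 9)) by (apply Rmult_le_pos; lra).
nra.
Qed.

Lemma sin_cos_poly (x : R) : 0 <= x <= 1 ->
  x * (1 - x * x / 6 * (1 - x * x / 20 * (1 - x * x / 42))) <= sin x /\
  sin x <= x * (1 - x * x / 6 * (1 - x * x / 20 * (1 - x * x / 42 * (1 - x * x / 72)))) /\
  cos x <= 1 - x * x / 2 * (1 - x * x / 12 * (1 - x * x / 30 * (1 - x * x / 56))) /\
  1 - x * x / 2 <= cos x.
Proof.
intros hx; assert (P2 := PI2_3_2).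
destruct (sin_bound x 1) as [s1 s2]; try lra.
destruct (cos_bound x 1) as [_ c2]; try lra.
destruct (cos_bound x 0) as [c1 _]; try lra.
unfold sin_approx, cos_approx, sin_term, cos_term in *; simpl Nat.mul in *; simpl Nat.add in *.
cbn [sum_f_R0] in *.
assert (F : forall k, INR (Factorial.fact (S k)) = INR (S k) * INR (Factorial.fact k)).
  intros k; change (Factorial.fact (S k)) with (S k * Factorial.fact k)%nat.
  rewrite mult_INR; reflexivity.
cbv beta iota zeta delta [Nat.add Nat.mul] in s1, s2, c1, c2.
assert (f0 : INR (Factorial.fact 0) = 1) by reflexivity.
rewrite !F, f0 in s1; rewrite !F, f0 in s2; rewrite !F, f0 in c1; rewrite !F, f0 in c2.
clear F f0; simpl INR in s1, s2, c1, c2.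
repeat split; eapply Rle_trans; try eassumption; apply Req_le; field.
Qed.

(* In units of [n], let [x] be the length of Max's run, [p x] the price of
   extending it and [d x] the deficit he needs.  An extension uses up
   [2 p + x], so that [d' = - (2 p + x)]; [slack] absorbs the rounding errors.
   While the cheaper end is that with a steep ascent, [d = (1 - x)^2 / 2 - r^2]
   for [p = 1 - x - r]; after [switch], [d = p^2], and [late_price], with
   [x + p + slack], runs along a logarithmic spiral. *)
Definition slack : R := 0.0000001.
Definition switch : R := 0.278464.
Definition final : R := 0.43909.

(** The parameter starts at 0.0001: at [r = 0] the length is stationary, so that the price would
    have infinite slope in it. This lowers the initial deficit by [0.0001 ^ 2]. *)
Definition early_length (r : R) : R :=
  - (r - 0.0001) - (1 + slack) / 2 * (ln (1 + slack - 2 * r) - ln (1 + slack - 2 * 0.0001)).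

(** With [d = p ^ 2] the equation for [d] becomes the linear system [p' = 2 p + x + slack],
    [x' = - 2 p], solved by this spiral; [s] runs backwards towards 0, where [p] vanishes. *)
Definition late_price (s : R) : R := 0.439091 * exp s * sin s.
Definition late_length (s : R) : R := 0.439091 * exp s * (cos s - sin s) - slack.

(** The arc reaches the length [switch] before [p] drops below [(1 - x) / 2], where the other price
    bound takes over. *)
Lemma early_length_end : switch <= early_length ((1 - switch) / 2).
Proof.
unfold early_length, switch, slack.
set (A := 1 + 0.0000001 - 2 * 0.0001); set (A' := 1 + 0.0000001 - 2 * ((1 - 0.278464) / 2)).
enough (0.639132 + 0.639132 <= ln A - ln A') by lra.
assert (A'0 : 0 < A') by (unfold A'; lra); assert (A0 : 0 < A) by (unfold A; lra).
rewrite <- ln_div by auto; rewrite <- (ln_exp (_ + _)).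
apply ln_le; [apply exp_pos|].
rewrite exp_plus; assert (E := exp_le_poly 0.639132 ltac:(lra)).
assert (E0 := exp_pos 0.639132).
match type of E with _ <= ?p => assert (E' : p <= 1.8948355) by lra end.
assert (exp 0.639132 * exp 0.639132 <= 1.8948355 * 1.8948355) by nra.
apply Rle_trans with (1 := H); apply Rmult_le_reg_r with A'; auto.
replace (A / A' * A') with A by (field; lra); unfold A, A'; lra.
Qed.

(** The room of 0.000001 in the price makes the deficit jump down from the arc to the spiral. *)
Lemma late_start :
  late_length 0.5138138 <= switch /\ late_price 0.5138138 <= (1 - switch) / 2 - 0.000001.
Proof.
unfold late_length, late_price, switch, slack.
assert (E := exp_le_poly 0.5138138 ltac:(lra)); assert (E0 := exp_pos 0.5138138).
destruct (sin_cos_poly 0.5138138 ltac:(lra)) as [s1 [s2 [c2 _]]].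
set (e := exp _) in *; set (s := sin _) in *; set (c := cos _) in *.
match type of E with _ <= ?p => assert (E' : p <= 1.67165442) by lra end.
match type of s1 with ?p <= _ => assert (s1' : 0.49150214 <= p) by lra end.
match type of s2 with _ <= ?p => assert (s2' : p <= 0.49150217) by lra end.
match type of c2 with _ <= ?p => assert (c2' : p <= 0.87087637) by lra end.
assert (e * (c - s) <= 1.67165442 * (0.87087637 - 0.49150214)) by nra.
assert (e * s <= 1.67165442 * 0.49150217) by nra.
split; lra.
Qed.

Lemma late_end : final <= late_length 0.001.
Proof.
unfold final, late_length, slack.
assert (E := exp_ineq1_le 0.001); assert (S := sin_lt_x 0.001 ltac:(lra)).
destruct (sin_cos_poly 0.001 ltac:(lra)) as [_ [_ [_ C]]].
assert ((1 + 0.001) * (1 - 0.001 * 0.001 / 2 - 0.001) <=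
  exp 0.001 * (cos 0.001 - sin 0.001)) by (apply Rmult_le_compat; lra).
lra.
Qed.

(** A discrete form of [d' = - (2 p + x + slack)]. The slope bound allows the price at [x] to be
    replaced by that one step later, at the cost of a constant. *)
Definition potential (d p : R -> R) (x0 x1 : R) : Prop :=
  forall x y, x0 <= x -> x <= y -> y <= x1 ->
  (y - x) * (2 * p y + x + slack) <= d x - d y /\ p x - p y <= 6000 * (y - x).

Lemma early_length_derive r : r <= 0.49 ->
  is_derive early_length r (2 * r / (1 + slack - 2 * r)).
Proof.
intros hr; unfold early_length, slack; auto_derive; [lra|field; lra].
Qed.

(* [len t0 <= x <= len t1] is reparametrized by the inverse of [len]. *)
Lemma potential_of_param (len D P len' P' : R -> R) (t0 t1 : R) : t0 <= t1 ->
  (forall t, t0 <= t <= t1 -> is_derive len t (len' t)) ->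
  (forall t, t0 <= t <= t1 -> is_derive P t (P' t)) ->
  (forall t, t0 <= t <= t1 ->
     is_derive D t (- (len' t * (2 * P t + len t + slack)))) ->
  (forall t, t0 <= t <= t1 -> 0 < len' t /\ 2 * P' t + len' t <= 0 /\
     0 <= P' t + 6000 * len' t) ->
  exists d p, potential d p (len t0) (len t1) /\
    forall x, len t0 <= x <= len t1 -> exists2 t, t0 <= t <= t1 &
      len t = x /\ d x = D t /\ p x = P t.
Proof.
intros t01 lenD PD DD sgn.
assert (lenM : forall r s, t0 <= r -> r <= s -> s <= t1 -> len r <= len s).
  intros r s hr rs hs; enough (- len s <= - len r) by lra.
  apply (decr_of_derive (fun t => - len t) (fun t => - len' t)); auto.
    intros t ht; apply (is_derive_opp len); apply lenD; lra.
  intros t ht; destruct (sgn t); lra.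
assert (Us : forall x, {t | len t0 <= x <= len t1 -> t0 <= t <= t1 /\ len t = x}).
  intros x; destruct (Rle_dec (len t0) x) as [x0|]; [|exists 0; lra].
  destruct (Rle_dec x (len t1)) as [x1|]; [|exists 0; lra].
  destruct (ivt_derive len len' t0 t1 x t01 lenD (conj x0 x1)) as [t h].
  now exists t.
set (U := fun x => proj1_sig (Us x)).
assert (hU : forall x, len t0 <= x <= len t1 -> t0 <= U x <= t1 /\ len (U x) = x).
  intros x; unfold U; destruct (Us x); auto.
exists (fun x => D (U x)), (fun x => P (U x)); split.
  intros x y x0 xy y1.
  destruct (hU x ltac:(lra)) as [hx ex], (hU y ltac:(lra)) as [hy ey].
  set (r := U x) in *; set (s := U y) in *.
  assert (rs : r <= s).
    destruct (Rle_lt_dec r s) as [|lt]; auto; exfalso.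
    destruct (MVT_cor2 len len' s r lt) as [t [e ht]].
      intros t ht; apply is_derive_Reals, lenD; lra.
    destruct (sgn t) as [h _]; [lra|nra].
  split.
    set (k := 2 * P s + x + slack).
    enough (D s + k * len s <= D r + k * len r) by (rewrite ex, ey in H; lra).
    apply (decr_of_derive (fun t => D t + k * len t)
      (fun t => - (len' t * (2 * P t + len t + slack)) + k * len' t)); auto.
      intros t ht; apply (is_derive_plus D); [apply DD; lra|].
      apply (is_derive_scal len); apply lenD; lra.
    intros t ht; destruct (sgn t ltac:(lra)) as [h1 [h2 h3]].
    (* Since [2 P + len] is nonincreasing, its least value between [r] and [s] is the one at [s]. *)
    enough (2 * P s + x <= 2 * P t + len t) by (unfold k; nra).
    apply Rle_trans with (2 * P s + len s); [lra|].
    apply (decr_of_derive (fun t => 2 * P t + len t) (fun t => 2 * P' t + len' t)); try lra.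
      intros u hu; apply (is_derive_plus (fun t => 2 * P t)); [|apply lenD; lra].
      apply (is_derive_scal P); apply PD; lra.
    intros u hu; destruct (sgn u); lra.
  enough (- (P s + 6000 * len s) <= - (P r + 6000 * len r)) by lra.
  apply (decr_of_derive (fun t => - (P t + 6000 * len t))
    (fun t => - (P' t + 6000 * len' t))); auto.
    intros t ht; apply (is_derive_opp (fun t => P t + 6000 * len t)).
    apply (is_derive_plus P); [apply PD; lra|].
    apply (is_derive_scal len); apply lenD; lra.
  intros t ht; destruct (sgn t); lra.
intros x hx; destruct (hU x hx) as [h e]; exists (U x); auto.
Qed.

Lemma early_curve : exists d p : R -> R, potential d p 0 switch /\
  forall x, 0 <= x <= switch -> 0.0001 <= 1 - x - p x /\ (1 - x) / 2 <= p x /\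
     d x = (1 - x) * (1 - x) / 2 - (1 - x - p x) * (1 - x - p x).
Proof.
set (r1 := (1 - switch) / 2).
assert (e1 : switch <= early_length r1) by exact early_length_end.
assert (e0 : early_length 0.0001 = 0) by (unfold early_length; lra).
assert (r1E : r1 = 0.360768) by (unfold r1, switch; lra).
destruct (potential_of_param early_length
  (fun t => (1 - early_length t) * (1 - early_length t) / 2 - t * t)
  (fun t => 1 - early_length t - t)
  (fun t => 2 * t / (1 + slack - 2 * t))
  (fun t => - (2 * t / (1 + slack - 2 * t)) - 1) 0.0001 r1) as [d [p [pot h]]].
- lra.
- intros t ht; apply early_length_derive; lra.
- intros t ht; assert (E := early_length_derive t ltac:(lra)).
  auto_derive; [repeat split; eexists; exact E|].
change (Derive (fun x : R => early_length x) t) with (Derive early_length t).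
  rewrite (is_derive_unique _ _ _ E); ring.
- intros t ht; assert (E := early_length_derive t ltac:(lra)).
  auto_derive; [repeat split; eexists; exact E|].
  change (Derive (fun x : R => early_length x) t) with (Derive early_length t).
  rewrite (is_derive_unique _ _ _ E); field; unfold slack; lra.
(* The length grows slowest at [t = 0.0001], at a rate of about 0.0002; the slope bound 6000 is
   chosen to exceed the inverse of this rate. *)
- intros t ht; enough (0.0002 <= 2 * t / (1 + slack - 2 * t)) by lra.
  unfold slack; apply Rmult_le_reg_r with (1 + 0.0000001 - 2 * t); [lra|].
  replace (2 * t / _ * _) with (2 * t) by (field; lra); nra.
- exists d, p; split.
    intros x y x0 xy y1; apply pot; lra.
  intros x hx; destruct (h x ltac:(lra)) as [t ht [ex [ed ep]]].
  rewrite ed, ep, ex; unfold switch in *; repeat split; try lra; field.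
Qed.

Lemma late_signs s : 0.001 <= s <= 0.5138138 ->
  0.0003 <= late_price s /\ 0 <= 0.439091 * exp s * cos s <= 1.4 /\ late_price s <= 1.4.
Proof.
intros hs; destruct (sin_cos_poly s ltac:(lra)) as [s1 [_ [_ c2]]].
assert (E1 := exp_ineq1_le s).
assert (E3 : exp s <= 3).
  apply Rle_trans with (exp 1); [left; apply exp_increasing; lra|apply exp_le_3].
unfold late_price.
assert (c01 : 0 <= cos s <= 1) by (split; [nra|apply COS_bound]).
assert (s01 : 0.0009 <= sin s <= 1).
  split; [|apply SIN_bound]; apply Rle_trans with (2 := s1).
  assert (h0 : 0 <= s * s <= 0.27) by nra.
  set (q := s * s) in *.
  assert (h : 0.9 <= 1 - q / 6 * (1 - q / 20 * (1 - q / 42))).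
    assert (0 <= q / 20 * (1 - q / 42) <= 1) by nra; nra.
  nra.
assert (0.0009 * 1 <= exp s * sin s) by (rewrite (Rmult_comm (exp s)); apply Rmult_le_compat; lra).
repeat split; nra.
Qed.

Lemma late_curve : exists d p : R -> R, potential d p switch final /\
  forall x, switch <= x <= final -> 0.0003 <= p x /\
    p x <= (1 - x) / 2 - 0.000001 /\ d x = p x * p x.
Proof.
destruct late_start as [ls lp]; assert (le := late_end).
set (P' := fun t => - (0.439091 * exp (- t) * (sin (- t) + cos (- t)))).
set (t0 := - 0.5138138); set (t1 := - 0.001).
assert (PD : forall t, is_derive (fun t => late_price (- t)) t (P' t)).
  intros t; unfold P', late_price; auto_derive; auto; ring.
assert (lenD : forall t, is_derive (fun t => late_length (- t)) t (2 * late_price (- t))).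
  intros t; unfold late_length, late_price; auto_derive; auto; ring.
assert (sgn : forall t, t0 <= t <= t1 -> P' t + late_price (- t) <= 0 /\ - 2.8 <= P' t).
  intros t ht; unfold t0, t1 in ht; destruct (late_signs (- t) ltac:(lra)) as [h1 [h2 h3]].
  unfold P', late_price in *; lra.
destruct (potential_of_param (fun t => late_length (- t))
  (fun t => late_price (- t) * late_price (- t)) (fun t => late_price (- t))
  (fun t => 2 * late_price (- t)) P' t0 t1) as [d [p [pot h]]].
- unfold t0, t1; lra.
- auto.
- auto.
- intros t ht; unfold late_length, late_price; auto_derive; auto; ring.
- intros t ht; destruct (sgn t ht); unfold t0, t1 in ht.
  destruct (late_signs (- t) ltac:(lra)) as [h1 [h2 h3]]; repeat split; lra.
- assert (e0 : - t0 = 0.5138138) by (unfold t0; lra).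
  assert (e1 : - t1 = 0.001) by (unfold t1; lra).
  rewrite e0, e1 in pot, h.
  exists d, p; split.
    intros x y x0 xy y1; apply pot; lra.
  intros x hx; destruct (h x ltac:(lra)) as [t ht [ex [ed ep]]].
  destruct (late_signs (- t) ltac:(unfold t0, t1 in ht; lra)) as [h1 _].
  rewrite ed, ep; repeat split; try lra.
  (* [p + x / 2] is nonincreasing, so the inequality has to be checked only at the start of the
     spiral. *)
  assert (E := decr_of_derive (fun t => late_price (- t) + / 2 * late_length (- t))
    (fun t => P' t + / 2 * (2 * late_price (- t))) t0 t (proj1 ht)).
  cbv beta in E; rewrite e0, ex in E.
  enough (late_price (- t) + / 2 * x <= late_price 0.5138138 + / 2 * late_length 0.5138138) by lra.
  apply E.
    intros u hu; apply (is_derive_plus (fun t => late_price (- t))); auto.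
    apply (is_derive_scal (fun t => late_length (- t))); auto.
  intros u hu; destruct (sgn u); unfold t1; lra.
Qed.

End Curves.

(** * Configurations of the complete graph as profiles on a cycle *)

Module Cycle.
Import all_boot boolp classical_sets zify.
Set Implicit Arguments.
Unset Strict Implicit.
Unset Printing Implicit Defensive.
Local Open Scope nat_scope.

Section Profile.
Variable n : nat.
Hypothesis n_gt1 : 1 < n.
Let n_gt0 : 0 < n := ltnW n_gt1.
Local Notation K_n := (complete_graph n).
Implicit Types (c d : config K_n) (v w : K_n) (a : nat -> nat).

(** If the chips of each vertex are stacked at heights 0, 1, ..., then the sum counts the chips at
    heights congruent to [i] mod [n]. The last summand makes firing a pure rotation. *)
Definition profile c (i : nat) : nat :=
  \sum_v ((c v + (n.-1 - i %% n)) %/ n) + (i %% n).+1.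

Definition raise a j i : nat := a i + (i == j %[mod n]).

Definition shift a s i : nat := a (s + i).

Definition is_profile a :=
  [/\ forall i, a (i + n) = a i, forall i, a i.+1 <= (a i).+1
    & exists i, n <= a i].

(** [j + n.-1] stands for the predecessor of [j] on the cycle. By [profile_count], the condition
    says that the number of chips on some vertex is congruent to [j]. *)
Definition playable a j := a j <= a (j + n.-1).

Definition deficit a : nat := \sum_(i < n) (n - a i).

Definition surplus a : nat := \sum_(i < n) (a i - n).

Lemma deg_complete v : deg v = n.-1.
Proof.
rewrite /deg; have -> : [set w : K_n | adj v w] = [set~ v].
  by apply/setP => w; rewrite !inE /= /complete_adj eq_sym.
by rewrite cardsC1 card_ord.
Qed.

Lemma profile_mod c i : profile c (i %% n) = profile c i.
Proof. by rewrite /profile modn_mod. Qed.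

Lemma profile_period c i : profile c (i + n) = profile c i.
Proof. by rewrite /profile modnDr. Qed.

Lemma pred_mod i : (i + n.-1) %% n = if i %% n is h.+1 then h else n.-1.
Proof.
rewrite -modnDml; case E: (i %% n) => [|h]; first by rewrite add0n modn_small // prednK.
have : i %% n < n by rewrite ltn_mod.
rewrite E => hn; rewrite addSnnS prednK // modnDr modn_small //; exact: ltnW.
Qed.

Lemma divn_step x h : h < n ->
  (x.+1 + (n.-1 - h)) %/ n = (x + (n.-1 - h)) %/ n + (x %% n == h).
Proof.
move=> hn; have := ltn_pmod x n_gt0; have := divn_eq x n.
set q := x %/ n; set r := x %% n => xE rn.
rewrite (_ : x.+1 + _ = q * n + (r.+1 + (n.-1 - h))); last by lia.
rewrite (_ : x + _ = q * n + (r + (n.-1 - h))); last by lia.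
rewrite !divnMDl // -addnA; congr (_ + _).
case: (ltngtP r h) => hr.
- by rewrite !divn_small //; lia.
- rewrite (_ : r.+1 + _ = n + (r - h)); last by lia.
  rewrite (_ : r + _ = n + (r - h).-1); last by lia.
  by rewrite !divnDl ?divnn // !(divn_small (m := _ - _)) ?divn_small ?addn0 //; lia.
- rewrite hr (_ : h.+1 + _ = n); last by lia.
  by rewrite divnn n_gt0 divn_small //; lia.
Qed.

(** Moving all heights up by one takes level [i - 1] to level [i] and the heights [0, ..., x - 1] to
    [1, ..., x]: height [x] is gained and height 0 is lost. *)
Lemma divn_pred x i :
  (x + (n.-1 - (i + n.-1) %% n)) %/ n + (i %% n == 0)
   = (x + (n.-1 - i %% n)) %/ n + (x == i %[mod n]).
Proof.
rewrite pred_mod; have := ltn_pmod i n_gt0; case: (i %% n) => [|h] hn /=.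
  have := divn_step x hn; rewrite subn0 addSnnS prednK // divnDr // divnn n_gt0.
  by rewrite subnn addn0 => ->.
have := divn_step x hn.
by rewrite (_ : x.+1 + (n.-1 - h.+1) = x + (n.-1 - h)) ?addn0 //; lia.
Qed.

Lemma profile_count c i :
  #|[set v : K_n | c v == i %[mod n]]| + profile c i = (profile c (i + n.-1)).+1.
Proof.
rewrite -sum1_card big_mkcond /= /profile.
have -> : \sum_v (if v \in [set v : K_n | c v == i %[mod n]] then 1 else 0)
   = \sum_v (c v == i %[mod n]) by apply: eq_bigr => v _; rewrite inE; case: eqP.
rewrite addnA -big_split /=; under eq_bigr => v _ do rewrite addnC -divn_pred.
rewrite big_split /= sum_nat_const card_ord.
by rewrite pred_mod; case: (i %% n) => [|h] /=; rewrite ?muln0; lia.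
Qed.

Lemma profile_fire c v i : firable c v ->
  profile (fire c v) i = profile c (i + n.-1).
Proof.
rewrite /firable deg_complete => cv; rewrite /profile.
(* As [- (n - 1) = 1 - n], firing gives every vertex one chip and then takes [n] from [v], that is,
   one chip from each level. *)
have E w : (fire c v w + (n.-1 - i %% n)) %/ n + (w == v) =
           (c w + (n.-1 - (i + n.-1) %% n)) %/ n + (i %% n == 0).
  rewrite divn_pred; case: (eqVneq w v) => [->|wv].
    have h := divn_step (c v) (ltn_pmod i n_gt0).
    rewrite -h ffunE eqxx deg_complete addn1 -[in LHS]addn1.
    have -> : 1 = n %/ n by rewrite divnn n_gt0.
    by rewrite -divnDr //; congr (_ %/ _); lia.
  rewrite ffunE (negbTE wv) addn0 /= /complete_adj eq_sym wv addn1.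
  by rewrite divn_step // ltn_mod.
have S : \sum_(w : K_n) (w == v) = 1.
  by rewrite (bigD1 v) //= eqxx big1 // => w /negbTE ->.
have : \sum_(w : K_n) ((fire c v w + (n.-1 - i %% n)) %/ n + (w == v)) =
   \sum_(w : K_n) ((c w + (n.-1 - (i + n.-1) %% n)) %/ n + (i %% n == 0)).
  by apply: eq_bigr => w _; exact: E.
rewrite !big_split /= S sum_nat_const card_ord.
rewrite pred_mod; have := ltn_pmod i n_gt0; case: (i %% n) => [|h] hn /=; lia.
Qed.

Lemma profile_add c v : profile (add_chip c v) = raise (profile c) (c v).
Proof.
apply/funext => i; rewrite /profile /raise addnAC; congr (_ + _).
rewrite (bigD1 v) //= [in RHS](bigD1 v) //= !ffunE eqxx addn1 addnAC eq_sym.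
rewrite divn_step ?ltn_mod //; congr (_ + _).
by apply: eq_bigr => w /negbTE wv; rewrite ffunE wv addn0.
Qed.

Lemma profile_is c : is_profile (profile c).
Proof.
split=> [i|i|]; first exact: profile_period.
  have := profile_count c i.+1; rewrite addSnnS prednK // profile_period.
  by move=> <-; rewrite leq_addl.
by exists n.-1; rewrite /profile modn_small ?prednK // ?leq_addl // ltn_predL.
Qed.

Lemma profile_playable c v : playable (profile c) (c v).
Proof.
rewrite /playable -ltnS -profile_count -add1n leq_add2r card_gt0.
by apply/set0Pn; exists v; rewrite inE.
Qed.

Lemma playable_profile c j : playable (profile c) j ->
  exists v : K_n, raise (profile c) j = profile (add_chip c v).
Proof.
rewrite /playable -ltnS -profile_count -add1n leq_add2r card_gt0.
case/set0Pn => v; rewrite inE => /eqP cv; exists v; rewrite profile_add.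
by apply/funext => i; rewrite /raise cv.
Qed.

Lemma profile_topples c d : topples c d ->
  exists s, profile d = shift (profile c) s.
Proof.
elim=> {c d} [c|c v d cv _ [s ->]]; first by exists 0; apply/funext.
exists (s + n.-1); apply/funext => i; rewrite /shift profile_fire //.
by rewrite addnAC.
Qed.

(** A vertex can be fired iff it has a chip at height [n - 2], and without any such chip the entry
    at [n - 2] is [n - 1]. *)
Lemma profile_stable c : stable c <-> profile c (n.-2) < n.
Proof.
have n2 : n.-2 %% n = n.-2 by rewrite modn_small //; lia.
have E v : ~~ firable c v = ((c v + (n.-1 - n.-2)) %/ n == 0).
  rewrite /firable deg_complete eqn0Ngt divn_gt0 //; lia.
rewrite /profile n2; split=> [cS|].
  by rewrite big1 ?add0n => [|v _]; [lia|apply/eqP; rewrite -E].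
rewrite (_ : _ < n = (\sum_v (c v + (n.-1 - n.-2)) %/ n == 0)); last first.
  by move: (\sum_v _) => m; lia.
by rewrite sum_nat_eq0 => /forallP H v; rewrite E; have := H v.
Qed.

Lemma profile_fire_first c s k :
  (forall i, firable (fire_first c s i) (s i)) ->
  forall i, profile (fire_first c s k) i = profile c (i + k * n.-1).
Proof.
move=> H; elim: k => [|k IH] i; first by rewrite addn0.
by rewrite /= profile_fire // IH mulSn addnA.
Qed.

Lemma volatile_profile c : volatile c <-> forall i, n <= profile c i.
Proof.
split=> [[s sP] i|H].
  rewrite leqNgt; apply/negP => ci.
  (* After this many firings the entry at [i] has been rotated to position [n - 2], where it decides
     whether a vertex can be fired. *)
  pose k := n.*2 - 2 - i %% n.
  suff /profile_stable /(_ (s k)) : profile (fire_first c s k) n.-2 < n by rewrite sP.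
  rewrite profile_fire_first // -profile_mod.
  suff -> : (n.-2 + k * n.-1) %% n = i %% n by rewrite profile_mod.
  have iN := ltn_pmod i n_gt0.
  have -> : n.-2 + k * n.-1 = k * n - n + i %% n.
    rewrite /k; move: iN; case: (n) n_gt1 => [|[|m]] //= _ iN.
    by move: (i %% _) iN => h hm; nia.
  have -> : k * n - n = k.-1 * n by rewrite -subn1 mulnBl mul1n.
  by rewrite modnMDl modn_mod.
apply: contrapT => cV; have [d [[//]|[_ cd /profile_stable dS]]] := settles_ex c.
by have [s E] := profile_topples cd; move: dS; rewrite E /shift ltnNge H.
Qed.

Definition start (i : nat) : nat := (i %% n).+1.

Lemma profile_empty : profile (empty_config K_n) = start.
Proof.
apply/funext => i; rewrite /profile /start big1 // => v _.
by rewrite ffunE add0n divn_small //; lia.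
Qed.

Lemma period_mul a k i : (forall j, a (j + n) = a j) -> a (i + k * n) = a i.
Proof. by move=> H; elim: k => [|k IH]; rewrite ?addn0 // mulSn addnCA addnC H. Qed.

Lemma period_mod a i : (forall j, a (j + n) = a j) -> a (i %% n) = a i.
Proof. by move=> H; rewrite [in RHS](divn_eq i n) addnC period_mul. Qed.

Lemma sum_shift (g : nat -> nat) s :
  (forall j, g (j + n) = g j) -> \sum_(i < n) g (s + i) = \sum_(i < n) g i.
Proof.
have B (F : nat -> nat) : \sum_(i < n) F i = \sum_(0 <= i < n.-1.+1) F i.
  by rewrite prednK // big_mkord.
move=> H; elim: s => [|s IH] //; rewrite -IH.
rewrite (B (fun i => g (s.+1 + i))) (B (fun i => g (s + i))).
rewrite big_nat_recr //= [RHS]big_nat_recl //= addnC; congr (_ + _).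
  by rewrite addn0 addSnnS (prednK n_gt0) H.
by apply: eq_bigr => i _; rewrite addSnnS.
Qed.

Lemma deficit_shift a s : is_profile a -> deficit (shift a s) = deficit a.
Proof.
by case=> H _ _; apply: (sum_shift (g := fun i => n - a i)) => j; rewrite H.
Qed.

Lemma surplus_shift a s : is_profile a -> surplus (shift a s) = surplus a.
Proof.
by case=> H _ _; apply: (sum_shift (g := fun i => a i - n)) => j; rewrite H.
Qed.

Lemma deficit_eq0 a : is_profile a -> (deficit a = 0 <-> forall i, n <= a i).
Proof.
case=> H _ _; split=> [/eqP|h]; last first.
  by rewrite /deficit big1 // => i _; apply/eqP; rewrite subn_eq0.
rewrite /deficit sum_nat_eq0 => /forallP h i; rewrite -(period_mod i H).
by have := h (Ordinal (ltn_pmod i n_gt0)); rewrite /= subn_eq0.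
Qed.

Lemma big_raise (G : nat -> nat) a j :
  \sum_(i < n) G (raise a j i) + G (a (j %% n))
  = \sum_(i < n) G (a i) + G (a (j %% n)).+1.
Proof.
have jn := ltn_pmod j n_gt0.
rewrite (bigD1 (Ordinal jn)) //= [in RHS](bigD1 (Ordinal jn)) //=.
rewrite /raise modn_mod eqxx addn1.
rewrite (eq_bigr (fun i : 'I_n => G (a i))) => [|i]; first by lia.
rewrite -val_eqE /= => ij; congr G.
by rewrite (modn_small (ltn_ord i)) (negbTE ij) addn0.
Qed.

Lemma raise_balance a j :
  deficit a + surplus (raise a j) = deficit (raise a j) + surplus a + 1.
Proof.
have h1 := big_raise (fun x => n - x) a j; have h2 := big_raise (fun x => x - n) a j.
rewrite /deficit /surplus; case: (leqP n (a (j %% n))) => h; lia.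
Qed.

Lemma settled_profile c v d : settles (add_chip c v) d ->
  exists s, profile d = shift (raise (profile c) (c v)) s.
Proof.
move=> [[_ ->]|[_ /profile_topples [s ->] _]]; rewrite profile_add; last by exists s.
by exists 0; apply/funext.
Qed.

Lemma raise_profile_is c v : is_profile (raise (profile c) (c v)).
Proof. by rewrite -profile_add; exact: profile_is. Qed.

(** * From strategies on profiles to bounds on the toppling number *)

Section Strategies.
(* Positions with Max, resp. Min, to move. *)
Variables I J : (nat -> nat) -> Prop.
Hypothesis I_shift : forall a s, is_profile a -> I a -> I (shift a s).
Hypothesis J_shift : forall a s, is_profile a -> J a -> J (shift a s).
Hypothesis I_start : I start.
Let inv p a := match p with Max => I a | Min => J a end.

Lemma inv_settled p c v d : inv p (raise (profile c) (c v)) ->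
  settles (add_chip c v) d ->
  [/\ inv p (profile d), deficit (profile d) = deficit (raise (profile c) (c v))
    & surplus (profile d) = surplus (raise (profile c) (c v))].
Proof.
move=> h /settled_profile [s ->]; have P := raise_profile_is c v.
rewrite deficit_shift // surplus_shift //; split=> //.
by case: p h => h; [exact: I_shift|exact: J_shift].
Qed.

(** By [raise_balance] every chip raises [surplus - deficit] by one, so the chips still to come
    number [deficit - surplus] plus the final surplus. The invariants must be closed under shifts
    because settling rotates the profile. *)
Lemma toppling_ge W :
  (forall a, is_profile a -> 0 < deficit a -> I a ->
    exists2 j, playable a j & J (raise a j)) ->
  (forall a j, is_profile a -> 0 < deficit a -> J a -> playable a j ->
    I (raise a j)) ->
  (forall a, is_profile a -> deficit a = 0 -> I a \/ J a -> W <= surplus a) ->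
  deficit start + W <= toppling_number K_n.
Proof.
move=> stepI stepJ final.
suff main p c k : optimal_length p c k -> inv p (profile c) ->
    deficit (profile c) + W <= k + surplus (profile c).
  have /main := toppling_numberP (Ordinal n_gt0 : K_n).
  rewrite profile_empty => /(_ I_start).
  suff -> : surplus start = 0 by rewrite addn0.
  rewrite /surplus big1 // => i _; apply/eqP.
  by rewrite subn_eq0 /start ltn_mod.
elim=> {p c k} [p c /volatile_profile cV ic|p c next len b cV nextP _ IH bP ic].
  have /deficit_eq0 D0 := cV; have {}D0 := D0 (profile_is c).
  rewrite D0 !add0n; apply: final => //; first exact: profile_is.
  by case: p ic; [left|right].
have D_gt0 : 0 < deficit (profile c).
  rewrite lt0n; apply/eqP => /(deficit_eq0 (profile_is c)) /volatile_profile.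
  exact: cV.
have step v : inv (opponent p) (raise (profile c) (c v)) ->
    deficit (profile c) + W <= len v + surplus (profile c) + 1.
  move=> h; have := raise_balance (profile c) (c v).
  by have [iv dE sE] := inv_settled h (nextP v); have := IH v iv; lia.
case: p ic bP {IH} step => /= ic bP step.
  have [j /playable_profile [v vE] jJ] := stepI _ (profile_is c) D_gt0 ic.
  have := bP v; move: (step v); rewrite -profile_add -vE => /(_ jJ); lia.
have := step b (stepJ _ _ (profile_is c) D_gt0 ic (profile_playable c b)); lia.
Qed.

Lemma toppling_le W :
  (forall a j, is_profile a -> 0 < deficit a -> I a -> playable a j ->
    J (raise a j)) ->
  (forall a, is_profile a -> 0 < deficit a -> J a ->
    exists2 j, playable a j & I (raise a j)) ->
  (forall a, is_profile a -> I a \/ J a -> surplus a <= W) ->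
  toppling_number K_n <= deficit start + W.
Proof.
move=> stepI stepJ bound.
suff main p c k : optimal_length p c k -> inv p (profile c) ->
    k + surplus (profile c) <= deficit (profile c) + W.
  have /main := toppling_numberP (Ordinal n_gt0 : K_n).
  by rewrite profile_empty => /(_ I_start); apply: leq_trans; exact: leq_addr.
elim=> {p c k} [p c _ ic|p c next len b cV nextP _ IH bP ic].
  rewrite add0n; apply: leq_trans (leq_addl _ _); apply: bound.
    exact: profile_is.
  by case: p ic; [left|right].
have D_gt0 : 0 < deficit (profile c).
  rewrite lt0n; apply/eqP => /(deficit_eq0 (profile_is c)) /volatile_profile.
  exact: cV.
have step v : inv (opponent p) (raise (profile c) (c v)) ->
    len v + surplus (profile c) + 1 <= deficit (profile c) + W.
  move=> h; have := raise_balance (profile c) (c v).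
  by have [iv dE sE] := inv_settled h (nextP v); have := IH v iv; lia.
case: p ic bP {IH} step => /= ic bP step.
  have := step b (stepI _ _ (profile_is c) D_gt0 ic (profile_playable c b)); lia.
have [j /playable_profile [v vE] jJ] := stepJ _ (profile_is c) D_gt0 ic.
have := bP v; move: (step v); rewrite -profile_add -vE => /(_ jJ); lia.
Qed.
End Strategies.
End Profile.

(** * Elementary properties of profiles and raises *)

Section ProfileLemmas.
Variable n : nat.
Hypothesis n_gt1 : 1 < n.
Let n_gt0 : 0 < n := ltnW n_gt1.
Implicit Types (a : nat -> nat).

Lemma profile_ge a i m : is_profile n a -> a (i + m) <= a i + m.
Proof.
case=> _ H _; elim: m => [|m IH]; first by rewrite !addn0.
by rewrite !addnS; apply: leq_trans (H _) _; rewrite ltnS.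
Qed.

Lemma periodE a i j : is_profile n a -> i = j %[mod n] -> a i = a j.
Proof. by case=> H _ _ ij; rewrite -(period_mod i H) ij period_mod. Qed.

Lemma le_raise a j i : a i <= raise n a j i.
Proof. exact: leq_addr. Qed.

Lemma deficit_raise a j : deficit n a <= (deficit n (raise n a j)).+1.
Proof.
have := big_raise n_gt1 (fun x => n - x) a j; rewrite /deficit; lia.
Qed.

Lemma deficit_raise_lt a j : is_profile n a -> a j < n ->
  deficit n a = (deficit n (raise n a j)).+1.
Proof.
move=> aP aj; have := big_raise n_gt1 (fun x => n - x) a j; rewrite /deficit.
rewrite (periodE aP (modn_mod j n)); lia.
Qed.

Lemma deficit_raise_ge a j : is_profile n a -> n <= a j ->
  deficit n (raise n a j) = deficit n a.
Proof.
move=> aP aj; have := big_raise n_gt1 (fun x => n - x) a j; rewrite /deficit.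
rewrite (periodE aP (modn_mod j n)); lia.
Qed.

Lemma argmin_playable a : is_profile n a -> exists2 j, playable n a j &
  forall i, a j <= a i.
Proof.
move=> aP; have [H _ _] := aP.
case: (@arg_minnP 'I_n (Ordinal n_gt0) predT (fun i => a i)) => // j _ jP.
have {}jP i : a j <= a i.
  by rewrite -(period_mod i H); exact: (jP (Ordinal (ltn_pmod i n_gt0))).
by exists j => //; exact: jP.
Qed.

Lemma deficit_gt0 a : is_profile n a -> 0 < deficit n a -> exists i, a i < n.
Proof.
move=> aP; rewrite lt0n => /eqP D; apply: contrapT => h; apply: D.
apply/(deficit_eq0 n_gt1 aP) => i; rewrite leqNgt; apply/negP => ai.
by apply: h; exists i.
Qed.

Lemma deficit_start : deficit n (start n) = \sum_(i < n) i.
Proof.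
rewrite /deficit (reindex_inj rev_ord_inj) /=; apply: eq_bigr => i _.
rewrite /start modn_small; have := ltn_ord i; lia.
Qed.

Lemma raise_is_profile a j : is_profile n a -> playable n a j ->
  is_profile n (raise n a j).
Proof.
move=> aP jP; have [aper aslope [m am]] := aP; split.
- by move=> i; rewrite /raise modnDr aper.
- move=> i; rewrite /raise; case: eqP => [ij|_]; last first.
    by rewrite addn0 (leq_trans (aslope i)) // ltnS leq_addr.
  rewrite addn1 ltnS; apply: leq_trans (leq_addr _ _).
  rewrite (periodE aP ij); apply: leq_trans jP _.
  rewrite (@periodE a _ i) //; have h : i.+1 + n.-1 = i + n by lia.
  by rewrite -modnDml -ij modnDml h modnDr.
- by exists m; apply: leq_trans am (le_raise _ _ _).
Qed.
End ProfileLemmas.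

(** * Max's strategy: extending a run *)

Section LowerBound.
Variable n : nat.
Hypothesis n_gt1 : 1 < n.
Let n_gt0 : 0 < n := ltnW n_gt1.
Implicit Types (a : nat -> nat).

(** The deficits contain two ramps [v, v - 1, ...], one from each end of the gap of [n - l]
    positions. If they do not fit side by side, one of them is cut to length [n - l - v]. *)
Definition price_bound l D v :=
  (v.*2 <= n - l -> v * v <= D) /\
  (n - l <= v.*2 -> (n - l) * (n - l) <= 2 * D + 2 * ((n - l - v) * (n - l - v))).

(* The plan at [p] is to raise the profile to the ramp [n - e, ..., n + l - 1]
   on [p, p + e + l), which contains a run of [l] positions without deficit. *)
Definition todo a p e l := \sum_(i < e + l) (n + i - e - a (p + i)).

Definition todo_deficit a p e l :=
  \sum_(i < e + l) (minn n (n + i - e) - a (p + i)).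

Lemma leq_todo a a' p e l : (forall i, a i <= a' i) -> todo a' p e l <= todo a p e l.
Proof. by move=> h; apply: leq_sum => i _; apply: leq_sub2l. Qed.

Lemma leq_todo_deficit a a' p e l : (forall i, a i <= a' i) ->
  todo_deficit a' p e l <= todo_deficit a p e l.
Proof. by move=> h; apply: leq_sum => i _; apply: leq_sub2l. Qed.

Lemma ltn_sum_ord m (F G : nat -> nat) k : k < m ->
  (forall i, F i <= G i) -> F k < G k -> \sum_(i < m) F i < \sum_(i < m) G i.
Proof.
move=> km FG FGk; rewrite (bigD1 (Ordinal km)) //= [X in _ < X](bigD1 (Ordinal km)) //=.
by rewrite -addSn leq_add //; apply: leq_sum.
Qed.

Lemma ramp_surplus a p e l : is_profile n a -> e + l <= n -> todo a p e l = 0 ->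
  \sum_(i < l) i <= surplus n a.
Proof.
move=> aP el /eqP; rewrite /todo sum_nat_eq0 => /forallP h.
rewrite -(surplus_shift n_gt1 (p + e) aP) /surplus /shift.
have ln : l <= n by lia.
rewrite -!(big_mkord xpredT (fun i => i)) -(big_mkord xpredT (fun i => a (p + e + i) - n)).
rewrite [X in _ <= X](big_cat_nat _ (n := l)) //=.
apply: leq_trans (leq_addr _ _); rewrite !big_mkord; apply: leq_sum => i _.
have iel : e + i < e + l by rewrite ltn_add2l.
have := h (Ordinal iel); rewrite /= (addnA p); lia.
Qed.

Lemma deficit_split a s l k v : is_profile n a -> l + k + v <= n ->
  \sum_(i < k) (n - a (s + l + i)) + \sum_(i < v) (n - a (s + n - v + i))
   <= deficit n a.
Proof.
move=> aP lkv; rewrite -(deficit_shift n_gt1 s aP) /deficit /shift.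
rewrite -[X in _ <= X](big_mkord xpredT (fun i => n - a (s + i))).
rewrite [X in _ <= X](big_cat_nat _ (n := l)) //=; last by lia.
rewrite (big_cat_nat _ (n := l + k) (m := l)) /=; [|lia..].
rewrite (big_cat_nat _ (n := n - v) (m := l + k)) /=; [|lia..].
have -> : \sum_(l <= i < l + k) (n - a (s + i)) = \sum_(i < k) (n - a (s + l + i)).
  rewrite -{1}(add0n l) big_addn addKn big_mkord; apply: eq_bigr => i _.
  by rewrite addnAC addnA.
have -> : \sum_(n - v <= i < n) (n - a (s + i)) = \sum_(i < v) (n - a (s + n - v + i)).
  rewrite -{1}(add0n (n - v)) big_addn (_ : n - (n - v) = v); last by lia.
  rewrite big_mkord; apply: eq_bigr => i _.
  by rewrite (_ : s + n - v + i = s + (i + (n - v))) //; lia.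
by apply: leq_trans (leq_addl _ _); rewrite leq_add2l leq_addl.
Qed.

Lemma sum_ramp v k : k <= v -> 2 * k * v <= 2 * (\sum_(i < k) (v - i)) + k * k.
Proof.
elim: k => [|k IH] kv; first by rewrite muln0.
rewrite big_ord_recr /=; have := IH (ltnW kv); move: (\sum_(_ < _) _) => S; nia.
Qed.

Lemma sum_tail v : v * v <= 2 * (\sum_(i < v) (v - i)).
Proof. by have := sum_ramp (leqnn v); nia. Qed.

(* The deficits next to either end of a run have slope at most one, so if both
   ends are expensive to extend, the deficits are large in total. *)
Lemma extend_run a s l : is_profile n a -> 0 < l -> l < n ->
  (forall i, i < l -> n + i <= a (s + i)) ->
  exists v, [/\ v <= n - l, price_bound l (deficit n a) v &
   exists p e, [/\ e + l.+1 <= n, n <= a (p + n.-1) + e.+1,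
     todo_deficit a p e l.+1 <= v & todo a p e l.+1 <= v + l]].
Proof.
move=> aP l_gt0 ln run; have [aper aslope _] := aP.
have run0 := run 0 l_gt0; rewrite !addn0 in run0.
have left j : j <= n -> n <= a (s + n - j) + j.
  move=> jn; have := profile_ge (s + n - j) j aP.
  rewrite subnK; last by lia.
  by rewrite aper; apply: leq_trans.
pose vR := n - a (s + l).
(* The largest such [e] is the length of the steep ascent into the run, on which
   [a (s - j) = n - j], as far as it lies in the gap. *)
pose P e := (e <= n - l) && [forall i : 'I_n, (0 < i <= e) ==> (a (s + n - i) + i <= n)].
have P0 : P 0 by apply/andP; split=> //; apply/forallP => i; case: (val i).
have exP : exists e, P e by exists 0.
have ubP e : P e -> e <= n - l by case/andP.
case: (ex_maxnP exP ubP) => e /andP [el /forallP eP] emax.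
have {}eP j : 0 < j <= e -> a (s + n - j) + j <= n.
  move=> je; have jn : j < n by lia.
  by have := eP (Ordinal jn); rewrite /= je.
have eS : e < n - l -> n < a (s + n - e.+1) + e.+1.
  move=> eln; rewrite ltnNge; apply/negP => h.
  suff /emax : P e.+1 by rewrite ltnn.
  apply/andP; split=> //; apply/forallP => i; apply/implyP => /andP [i0].
  rewrite leq_eqVlt => /orP [/eqP -> //|ie]; apply: eP; lia.
exists (minn vR e); set v := minn vR e.
have v_vR : v <= vR := geq_minl _ _; have v_e : v <= e := geq_minr _ _.
split; first by lia.
  have D1 k : \sum_(i < k) (v - i) <= \sum_(i < k) (n - a (s + l + i)).
    apply: leq_sum => i _; have := profile_ge (s + l) i aP; rewrite /vR in v_vR; lia.
  have D2 : \sum_(i < v) (v - i) <= \sum_(i < v) (n - a (s + n - v + i)).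
    apply: leq_sum => i _; have iv := ltn_ord i.
    have := eP (v - i); rewrite (_ : s + n - (v - i) = s + n - v + i); lia.
  have tail := sum_tail v; split=> vg.
    have h : _ := @deficit_split a s l v v aP ltac:(lia).
    have h1 := D1 v; have := leq_trans (leq_add h1 D2) h.
    by move: (\sum_(i < v) (v - i)) tail (deficit n a) => S tail D; nia.
  have h := @deficit_split a s l (n - l - v) v aP.
  have {}h := leq_trans (leq_add (D1 (n - l - v)) D2) (h ltac:(lia)).
  have := sum_ramp (k := n - l - v) (v := v) ltac:(lia).
  have aux u S1 S2 g D : g = u + v -> 2 * u * v <= 2 * S1 + u * u ->
      v * v <= 2 * S2 -> S1 + S2 <= D -> g * g <= 2 * D + 2 * (u * u).
    by move=> ->; nia.
  by move=> ramp; apply: (aux (n - l - v)) ramp tail h; lia.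
have todo_right : exists p e, [/\ e + l.+1 <= n, n <= a (p + n.-1) + e.+1,
    todo_deficit a p e l.+1 <= vR & todo a p e l.+1 <= vR + l].
  exists s, 0; split=> //.
  - have := left 1 n_gt0; rewrite -addnBA // subn1; lia.
  - rewrite /todo_deficit add0n big_ord_recr /= big1 => [|i _]; first by rewrite /vR; lia.
    have := run i (ltn_ord i); lia.
  - rewrite /todo add0n big_ord_recr /= big1 => [|i _]; first by rewrite /vR; lia.
    have := run i (ltn_ord i); lia.
have todo_left : exists p e', [/\ e' + l.+1 <= n, n <= a (p + n.-1) + e'.+1,
    todo_deficit a p e' l.+1 <= e & todo a p e' l.+1 <= e + l].
  (* Lifting the ascent and the run by one puts one more position at [n] or above. If [e = 0], the
     position before the run is already at [n] or above and is simply added. *)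
  pose q := e.-1; pose p := s + n - q.+1.
  have ends i : i < q.+1 -> n + i - q - a (p + i) <= (0 < e).
    move=> iq; rewrite (_ : p + i = s + n - (q.+1 - i)); last by lia.
    have := left (q.+1 - i); case: (posnP e) => [e0|e_gt0]; last by lia.
    have q0 : q = 0 by rewrite /q e0.
    have := eS; rewrite e0 (_ : q.+1 - i = 1); lia.
  have inner i : i < l -> n + (q.+1 + i) - q - a (p + (q.+1 + i)) <= 1 /\
      n <= a (p + (q.+1 + i)).
    move=> il; rewrite (_ : p + (q.+1 + i) = s + i + n); last by lia.
    by rewrite aper; have := run i il; lia.
  have qe : q.+1 * (0 < e) <= e by rewrite /q; case: (posnP e) => h; rewrite ?muln0 ?muln1; lia.
  exists p, q; rewrite /todo_deficit /todo addnS -addSn !big_split_ord /=; split.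
  - lia.
  - have [e_lt|] := ltnP e (n - l); last first.
      move=> h; have eE : e = n - l by lia.
      rewrite (_ : p + n.-1 = s + l.-1 + n); last by lia.
      by rewrite aper; have := run l.-1; lia.
    rewrite (_ : p + n.-1 = s + n - q.+2 + n); last by lia.
    rewrite aper; have := eS e_lt; case: (posnP e) => [e0|e_gt0].
      have := profile_ge (s + n - 2) 1 aP; rewrite /q e0 /=.
      rewrite (_ : s + n - 2 + 1 = s + n - 1); last by lia.
      by move: (a _) (a _) => x y; lia.
    by rewrite /q prednK //; lia.
  - rewrite [X in _ + X]big1 => [|i _]; last by have := inner i (ltn_ord i); lia.
    rewrite addn0; apply: leq_trans qe; rewrite -[X in X * _](card_ord q.+1) -sum_nat_const.
    by apply: leq_sum => i _; have := ends i (ltn_ord i); lia.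
  - apply: leq_add.
      apply: leq_trans qe; rewrite -[X in X * _](card_ord q.+1) -sum_nat_const.
      by apply: leq_sum => i _; exact: ends.
    rewrite -[X in _ <= X](card_ord l) -sum1_card; apply: leq_sum => i _.
    by have [] := inner i (ltn_ord i).
rewrite /v; case: (leqP vR e) => _; [exact: todo_right|exact: todo_left].
Qed.

Lemma shift_back a s p i : is_profile n a -> shift a s (p + n.-1 * s + i) = a (p + i).
Proof.
move=> [aper _ _]; rewrite /shift.
by rewrite (_ : s + _ = p + i + s * n) ?period_mul //; case: (n) n_gt0 => // m _ /=; nia.
Qed.

Lemma todo_shift a s p e l : is_profile n a ->
  todo (shift a s) (p + n.-1 * s) e l = todo a p e l.
Proof. by move=> aP; apply: eq_bigr => i _; rewrite shift_back. Qed.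

Lemma todo_deficit_shift a s p e l : is_profile n a ->
  todo_deficit (shift a s) (p + n.-1 * s) e l = todo_deficit a p e l.
Proof. by move=> aP; apply: eq_bigr => i _; rewrite shift_back. Qed.

Section Game.
(** [enough l D]: a deficit [D] suffices to extend a run from length [l] to [last]. An extension at
    price [v] uses up [2 v + l], namely [v] by Max and [v + l] by Min. *)
Variables (last : nat) (enough : nat -> nat -> Prop).
Hypothesis last_le : last <= n.
Hypothesis enoughW : forall l D D', enough l D -> D <= D' -> enough l D'.
Hypothesis enough_start : enough 1 (deficit n (start n)).
Hypothesis enough0 : forall l, enough l 0 -> last <= l.
Hypothesis enough_step : forall l D v, 0 < l -> l < last -> v <= n - l ->
  price_bound l D v -> enough l D ->
  2 * v + l <= D /\ enough l.+1 (D - (2 * v + l)).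

(* [m] is the number of moves Max owes: 1 when Min is about to move. *)
Definition on_track m a := \sum_(i < last) i <= surplus n a \/
  exists p e l, [/\ 0 < l <= last, e + l <= n, n <= a (p + n.-1) + e.+1,
    todo_deficit a p e l + todo a p e l + m <= deficit n a
    & enough l (deficit n a - (todo_deficit a p e l + todo a p e l + m))].

Lemma on_track_shift m a s : is_profile n a -> on_track m a -> on_track m (shift a s).
Proof.
move=> aP [h|[p [e [l [ll el bd le en]]]]]; first by left; rewrite surplus_shift.
right; exists (p + n.-1 * s), e, l.
by rewrite todo_shift // todo_deficit_shift // deficit_shift // shift_back.
Qed.

Lemma surplus_raise a j : surplus n a <= surplus n (raise n a j).
Proof. by apply: leq_sum => i _; apply: leq_sub2r; exact: le_raise. Qed.

Lemma on_track_max a : is_profile n a -> 0 < deficit n a -> on_track 0 a ->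
  exists2 j, playable n a j & on_track 1 (raise n a j).
Proof.
move=> aP D0 track; have [aper _ _] := aP.
have trivial_move : \sum_(i < last) i <= surplus n a ->
    exists2 j, playable n a j & on_track 1 (raise n a j).
  move=> h; have [j jP _] := argmin_playable n_gt1 aP; exists j => //.
  by left; apply: leq_trans h (surplus_raise _ _).
have plan_move p e l : 0 < l <= last -> e + l <= n -> n <= a (p + n.-1) + e.+1 ->
    0 < todo a p e l -> todo_deficit a p e l + todo a p e l <= deficit n a ->
    enough l (deficit n a - (todo_deficit a p e l + todo a p e l)) ->
    exists2 j, playable n a j & on_track 1 (raise n a j).
  move=> ll el bd todo_gt0 le en.
  have exi : exists i, (i < e + l) && (a (p + i) < n + i - e).
    move: todo_gt0; rewrite lt0n /todo sum_nat_eq0 => /forallPn [i].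
    rewrite /= subn_eq0 -ltnNge => h; by exists i; rewrite ltn_ord.
  case: (ex_minnP exi) => i /andP [iel ai] imin.
  (* The first entry below the ramp is playable: its predecessor is on the ramp or, at the start of
     the plan, is at least [n - e - 1]. *)
  have jP : playable n a (p + i).
    rewrite /playable; case: i iel ai imin => [|i] iel ai imin; first by rewrite !addn0 in ai *; lia.
    rewrite (_ : p + i.+1 + n.-1 = p + i + n); last by lia.
    rewrite aper leqNgt; apply/negP => h.
    have := imin i; rewrite ltnn; suff -> : (i < e + l) && (a (p + i) < n + i - e) by move=> /(_ isT).
    by lia.
  exists (p + i) => //; right; exists p, e, l.
  have up k := le_raise n a (p + i) k.
  have aS : raise n a (p + i) (p + i) = (a (p + i)).+1 by rewrite /raise eqxx addn1.
  have todo_lt : todo (raise n a (p + i)) p e l < todo a p e l.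
    apply: (@ltn_sum_ord _ (fun k => n + k - e - raise n a (p + i) (p + k))
      (fun k => n + k - e - a (p + k)) _ iel) => [k|]; first by apply: leq_sub2l.
    by rewrite aS; lia.
  have todo_deficit_lt : a (p + i) < n ->
      todo_deficit (raise n a (p + i)) p e l < todo_deficit a p e l.
    move=> h; apply: (@ltn_sum_ord _
      (fun k => minn n (n + k - e) - raise n a (p + i) (p + k))
      (fun k => minn n (n + k - e) - a (p + k)) _ iel) => [k|].
      by apply: leq_sub2l.
    by rewrite aS; lia.
  split=> //; first by have := up (p + n.-1); lia.
    case: (ltnP (a (p + i)) n) => h; last first.
      have td_le := leq_todo_deficit p e l up.
      by rewrite (deficit_raise_ge n_gt1 aP h); lia.
    have := todo_deficit_lt h.
    have := deficit_raise_lt n_gt1 aP h; lia.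
  apply: enoughW en _; case: (ltnP (a (p + i)) n) => h; last first.
    have td_le := leq_todo_deficit p e l up.
      by rewrite (deficit_raise_ge n_gt1 aP h); lia.
  have := todo_deficit_lt h.
  have := deficit_raise_lt n_gt1 aP h; lia.
case: track => [//|[p [e [l [ll el bd]]]]]; rewrite !addn0.
(* A fulfilled plan is replaced by one for a longer run, repeatedly, since the new plan may already
   be fulfilled as well. *)
have [k] := ubnP (last - l); elim: k => // k IH in p e l ll el bd *.
move=> lk le en.
case: (posnP (todo a p e l)) => [todo0|]; last by move=> t; apply: (plan_move p e l).
have [l_last|] := ltnP l last; last first.
  move=> l_last; apply: trivial_move; have := ramp_surplus aP el todo0.
  by rewrite (_ : l = last) //; lia.
have run i : i < l -> n + i <= a (p + e + i).
  move=> il; have iel : e + i < e + l by lia.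
  move/eqP: todo0; rewrite /todo sum_nat_eq0 => /forallP /(_ (Ordinal iel)) /=.
  rewrite (addnA p); lia.
have tdef0 : todo_deficit a p e l = 0.
  apply/eqP; rewrite -leqn0 -todo0; apply: leq_sum => i _; apply: leq_sub2r.
  exact: geq_minr.
rewrite todo0 tdef0 subn0 in en.
have l_gt0 : 0 < l by lia.
have [v [vn vP [p' [e' [el' bd' td' t']]]]] := extend_run aP l_gt0 ltac:(lia) run.
have [vD enD] := enough_step l_gt0 l_last vn vP en.
apply: (IH p' e' l.+1) => //; [lia..|].
by apply: enoughW enD _; lia.
Qed.

Lemma on_track_min a j : is_profile n a -> 0 < deficit n a -> on_track 1 a ->
  playable n a j -> on_track 0 (raise n a j).
Proof.
move=> aP D0 [h|[p [e [l [ll el bd le en]]]]] _.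
  by left; apply: leq_trans h (surplus_raise _ _).
right; exists p, e, l; have up k := le_raise n a j k.
have d1 := leq_todo p e l up; have d2 := leq_todo_deficit p e l up.
have d3 := deficit_raise n_gt1 a j; rewrite addn0; split=> //.
- by have := up (p + n.-1); lia.
- lia.
- by apply: enoughW en _; lia.
Qed.

Theorem lower_game :
  \sum_(i < n) i + \sum_(i < last) i <= toppling_number (complete_graph n).
Proof.
rewrite -(deficit_start n_gt1).
apply: (toppling_ge n_gt1 (I := on_track 0) (J := on_track 1)).
- by move=> a s; exact: on_track_shift.
- by move=> a s; exact: on_track_shift.
- have [E|last_gt0] := posnP last; first by left; rewrite E big_ord0.
  (* The initial profile climbs from 1 to [n], so its last entry is a run of length one. *)
  right; exists n.-1, 0, 1.
  have E : todo (start n) n.-1 0 1 = 0.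
    by rewrite /todo big_ord1 /start !addn0 modn_small; lia.
  have E' : todo_deficit (start n) n.-1 0 1 = 0.
    by rewrite /todo_deficit big_ord1 /start !addn0 modn_small; lia.
  rewrite E E' subn0; split=> //; rewrite /start.
  by rewrite (_ : n.-1 + n.-1 = n.-2 + n) ?modnDr ?modn_small; lia.
- exact: on_track_max.
- exact: on_track_min.
- move=> a aP D0 track.
  have run : on_track 0 a.
    case: track => // -[h|[p [e [l [_ _ _ h _]]]]]; [by left|lia].
  case: run => // -[p [e [l [ll el bd le en]]]].
  rewrite D0 in le en; have l_ge : last <= l by apply: enough0; exact: en.
  have -> : last = l by apply/eqP; rewrite eqn_leq l_ge; case/andP: ll.
  by apply: (ramp_surplus (p := p) aP el); move: le; rewrite addn0 leqn0 addn_eq0 => /andP [_ /eqP].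
Qed.
End Game.
End LowerBound.

Lemma double_sum_ord k : 2 * \sum_(j < k) j = k * k.-1.
Proof.
elim: k => [|k IH]; first by rewrite big_ord0.
by rewrite big_ord_recr /= mulnDr IH; case: (k) => //= m; nia.
Qed.

(** * Min's strategy: filling the minima *)

Section UpperBound.
Variable n : nat.
Hypothesis n_gt1 : 1 < n.
Let n_gt0 : 0 < n := ltnW n_gt1.
Implicit Types (a : nat -> nat).

Definition count_ge a t := \sum_(i < n) (t <= a i).

Definition capped k a := \sum_(i < n) minn k (n - a i).

(** An ascending profile skips no level, because its slope is at most one. *)
Lemma level_attained a t : is_profile n a -> (exists i, a i < t) ->
  (exists i, t <= a i) -> exists i : 'I_n, a i = t.
Proof.
move=> aP [i ai] [j aj]; have [aper aslope _] := aP.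
pose P m := (t <= a (i + m)).
have exP : exists m, P m.
  exists (n * i + j - i); rewrite /P (_ : i + _ = j + i * n); last first.
    by case: (n) n_gt0 => // m _; nia.
  by rewrite period_mul.
case: (ex_minnP exP) => m Pm mmin.
have m_gt0 : 0 < m by rewrite lt0n; apply/eqP => m0; move: Pm; rewrite /P m0 addn0; lia.
have lt : a (i + m.-1) < t.
  rewrite ltnNge; apply/negP => h; have := mmin _ h; lia.
have := aslope (i + m.-1); rewrite -addnS prednK // => h.
exists (Ordinal (ltn_pmod (i + m) n_gt0)); rewrite /= period_mod //.
apply/eqP; rewrite eqn_leq; apply/andP; split; [exact: leq_trans h lt|exact: Pm].
Qed.

Lemma count_ge_lt a t : (exists i : 'I_n, a i = t) ->
  count_ge a t.+1 < count_ge a t.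
Proof.
move=> [i ai]; rewrite /count_ge (bigD1 i) //= [X in _ < X](bigD1 i) //=.
rewrite ai ltnn leqnn add0n add1n ltnS; apply: leq_sum => j _.
by case: (ltnP t (a j)) => // /ltnW ->.
Qed.

Lemma minn_sum k x : minn k x = \sum_(j < k) (j < x).
Proof.
elim: k => [|k IH]; first by rewrite big_ord0 min0n.
by rewrite big_ord_recr /= -IH; case: ltnP => h; lia.
Qed.

(** Both sides count pairs of a position and one of the top [k] levels below [n], split by whether
    the profile reaches that level. *)
Lemma capped_count a k : k <= n ->
  capped k a + \sum_(j < k) count_ge a (n - j) = k * n.
Proof.
move=> kn; rewrite /capped /count_ge.
under eq_bigr => i _ do rewrite minn_sum.
rewrite exchange_big -big_split /= -[k in RHS](card_ord k) -sum_nat_const.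
apply: eq_bigr => j _; rewrite -big_split /= -[RHS](card_ord n) -sum1_card.
by apply: eq_bigr => i _; have := ltn_ord j; case: leqP => h; lia.
Qed.

Lemma count_ge_step a j : is_profile n a -> (exists i, a i + j < n) ->
  count_ge a (n - j) < count_ge a (n - j.+1).
Proof.
move=> aP [i ai]; have [_ _ [m am]] := aP.
have -> : n - j = (n - j.+1).+1 by lia.
apply: count_ge_lt; have [e|h] := eqVneq (a i) (n - j.+1).
  have [aper _ _] := aP; exists (Ordinal (ltn_pmod i n_gt0)).
  by rewrite /= period_mod.
by apply: level_attained => //; [exists i; lia|exists m; lia].
Qed.

Lemma count_ge_mono a j k : is_profile n a -> j <= k -> (exists i, a i + k <= n) ->
  count_ge a (n - j) + (k - j) <= count_ge a (n - k).
Proof.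
move=> aP; elim: k => [|k IH]; first by rewrite leqn0 => /eqP -> _; rewrite addn0.
rewrite leq_eqVlt => /orP [/eqP ->|jk] [i ai]; first by rewrite subnn addn0.
have h1 : exists i, a i + k < n by exists i; lia.
have := count_ge_step aP h1; have := IH jk ltac:(by exists i; lia); lia.
Qed.

Lemma capped_pred a k : 0 < k -> k <= n ->
  capped k a = capped k.-1 a + (n - count_ge a (n - k.-1)).
Proof.
case: k => // k _ kn /=; have := capped_count a kn.
have := capped_count a (ltnW kn); rewrite big_ord_recr /=.
have : count_ge a (n - k) <= n.
  rewrite -[X in _ <= X](card_ord n) -sum1_card; apply: leq_sum => i _.
  exact: leq_b1.
nia.
Qed.

(* Each of the values [n - 1, ..., n - k + 1] is attained. *)
Lemma capped_ge a k : is_profile n a -> 0 < k -> k <= n ->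
  (exists i, a i + k.-1 <= n) ->
  2 * k * (n - count_ge a (n - k.-1)) + k * k.-1 <= 2 * capped k a.
Proof.
move=> aP k0 kn low; have := capped_count a kn.
have S : \sum_(j < k) count_ge a (n - j) + \sum_(j < k) (k.-1 - j)
    <= k * count_ge a (n - k.-1).
  rewrite -big_split /= -[k in k * _](card_ord k) -sum_nat_const.
  by apply: leq_sum => j _; apply: count_ge_mono => //; have := ltn_ord j; lia.
have T : \sum_(j < k) (k.-1 - j) = \sum_(j < k) j.
  rewrite [RHS](reindex_inj rev_ord_inj) /=; apply: eq_bigr => j _.
  have := ltn_ord j; lia.
have := double_sum_ord k; rewrite -T => h1 h2.
have CN : count_ge a (n - k.-1) <= n.
  rewrite -[X in _ <= X](card_ord n) -sum1_card; apply: leq_sum => i _.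
  exact: leq_b1.
have := leq_mul (leqnn k) CN; rewrite -mulnA mulnBr; lia.
Qed.

(** As every level down to depth [k - 1] is attained, at least [count_ge a n + j] entries reach
    level [n - j]. *)
Lemma capped_le a k : is_profile n a -> 0 < k -> k <= n ->
  (exists i, a i + k.-1 <= n) ->
  2 * capped k a + 2 * k * count_ge a n + k * k.-1 <= 2 * k * n.
Proof.
move=> aP k0 kn [i ai]; have := capped_count a kn.
have S : k * count_ge a n + \sum_(j < k) j <= \sum_(j < k) count_ge a (n - j).
  rewrite -[k in k * _](card_ord k) -sum_nat_const -big_split /=.
  apply: leq_sum => j _; have jk := ltn_ord j.
  have low : exists i, a i + j <= n by exists i; lia.
  by have := count_ge_mono aP (leq0n j) low; rewrite !subn0.
have T := double_sum_ord k; rewrite -!mulnA; lia.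
Qed.

(** Above [n] no level is skipped either, so each one is reached by fewer entries than the previous
    one. *)
Lemma surplus_le a : is_profile n a -> 0 < deficit n a ->
  2 * surplus n a + count_ge a n <= count_ge a n * count_ge a n.
Proof.
move=> aP D0; have [i0 ai0] := deficit_gt0 n_gt1 aP D0.
set F := count_ge a n.
have cF j : count_ge a (n + j) <= F - j.
  elim: j => [|j IH]; first by rewrite addn0 subn0.
  rewrite addnS; case: (pselect (exists i, n + j <= a i)) => [h|h].
    have := count_ge_lt (level_attained aP (ex_intro _ i0 _) h); lia.
  rewrite (_ : count_ge _ _ = 0) // /count_ge big1 // => i _.
  by apply/eqP; rewrite eqb0 -ltnNge ltnS leqNgt; apply/negP => hh; apply: h; exists i; lia.
have S m : \sum_(i < n) minn m (a i - n) = \sum_(j < m) count_ge a (n + j.+1).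
  under eq_bigr => i _ do rewrite minn_sum.
  rewrite exchange_big; apply: eq_bigr => j _; apply: eq_bigr => i _.
  by rewrite addnS; case: leqP => h; lia.
have B m : 2 * (\sum_(j < m) (F - j.+1)) + F <= F * F.
  elim: m F {cF} => [|m IH] F; first by rewrite big_ord0; nia.
  case: F => [|F]; first by rewrite big1.
  by rewrite big_ord_recl /= subSS subn0; have := IH F; under eq_bigr => j _ do rewrite subSS; nia.
have E : surplus n a = \sum_(i < n) minn (surplus n a) (a i - n).
  rewrite [LHS]/surplus; apply: eq_bigr => i _; apply/esym/minn_idPr.
  by rewrite /surplus (bigD1 i) //= leq_addr.
apply: leq_trans (B (surplus n a)); rewrite leq_add2r leq_mul2l /= [X in X <= _]E S.
by apply: leq_sum => j _; exact: cF.
Qed.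

Lemma capped_raise a j k : is_profile n a ->
  capped k a = capped k (raise n a j) + ((a j < n) && (n <= a j + k)).
Proof.
move=> aP; have := big_raise n_gt1 (fun x => minn k (n - x)) a j; rewrite /capped.
rewrite (periodE aP (modn_mod j n)); case: ltnP => h1; case: leqP => h2 /=; lia.
Qed.

Lemma deficit_capped a k : (forall i, n <= a i + k.+1) ->
  deficit n a <= capped k a + n.
Proof.
move=> h; rewrite -[X in _ + X](card_ord n) -sum1_card -big_split /=.
by apply: leq_sum => i _; have := h i; lia.
Qed.

Section Game.
(** [good k E Z]: at depth [k + 1] with capped deficit [E], Min can allow [deficit + surplus = Z].
    In [good_step], a chip of Max above the minimum but below [n] and Min's reply together lower [E]
    by one and [Z] by two. *)
Variables (good : nat -> nat -> nat -> Prop) (W : nat).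
Hypothesis n_gt2 : 2 < n.
Hypothesis good_le : forall k E Z Z', good k E Z -> Z' <= Z -> good k E Z'.
Hypothesis good_pred : forall k E q Z, 1 < k -> good k (E + q) Z ->
  2 * k * q + k * k.-1 <= 2 * (E + q) -> good k.-1 E Z.
Hypothesis good_step : forall k E F Z w, 0 < k -> k < n -> good k E.+1 Z.+2 ->
  Z <= E + n + w -> 2 * w + F <= F * F -> 2 * E + 2 * k * F + k * k.-1 <= 2 * k * n ->
  good k E Z.
Hypothesis good_bound : forall k E F Z w, 0 < k -> k < n -> good k E Z ->
  w <= Z -> 2 * w + F <= F * F -> 2 * E + 2 * k * F + k * k.-1 <= 2 * k * n ->
  w <= W.
Hypothesis good_start : forall E Z, 2 * E + 2 = n * n.-1 -> 2 * Z = n * n.-1 ->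
  good n.-2 E Z.

(** The depth is exactly [k + 1], one more than the cap, so that chips on a minimum do not affect
    [capped k a]. *)
Definition bounded a Z := exists k, [/\ 0 < k < n, forall i, n <= a i + k.+1,
  exists i, a i + k.+1 <= n & good k (capped k a) Z].

(** When the last minimum is gone, [k] is lowered to fit the new depth, by [good_pred] with its
    premise from [capped_ge]. If this leads to depth at most one, the profile is almost full. *)
Lemma normalize a k Z : is_profile n a -> 0 < k < n ->
  (forall i, n <= a i + k.+1) -> (exists i, a i + k.-1 <= n) ->
  good k (capped k a) Z ->
  ((forall i, n <= a i + 1) /\ good 1 (capped 1 a) Z) \/ bounded a Z.
Proof.
move=> aP; elim: k => // k IH kn le ex g.
case: (pselect (exists i, a i + k.+2 <= n)) => [ex'|nex].
  by right; exists k.+1.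
have le' i : n <= a i + k.+1.
  by rewrite leqNgt; apply/negP => h; apply: nex; exists i; lia.
have [k0|k_gt0] := posnP k; first by left; move: le' g; rewrite k0.
have [i ai] := ex; apply: IH => //; [lia|by exists i; lia|].
apply: (@good_pred k.+1 _ (n - count_ge a (n - k))) => //.
  by rewrite -[capped k a]/(capped k.+1.-1 a) -capped_pred //; lia.
rewrite -[capped k a]/(capped k.+1.-1 a) -capped_pred //; last by lia.
by apply: capped_ge => //; lia.
Qed.

Lemma low_surplus a k Z : is_profile n a -> 0 < k < n -> 0 < deficit n a ->
  (exists i, a i + k.-1 <= n) -> good k (capped k a) Z -> surplus n a <= Z ->
  surplus n a <= W.
Proof.
move=> aP /andP [k0 kn] D0 low g wZ.
apply: (good_bound k0 kn g wZ (surplus_le aP D0)).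
by apply: capped_le => //; exact: ltnW.
Qed.

Lemma deficit_flat a : (forall i, n <= a i + 1) -> deficit n a <= n.
Proof.
move=> h; rewrite -[X in _ <= X](card_ord n) -sum1_card.
by apply: leq_sum => i _; have := h i; lia.
Qed.

Lemma deficit_gt0I a i : is_profile n a -> a i < n -> 0 < deficit n a.
Proof.
move=> aP ai; rewrite lt0n; apply/eqP => /(deficit_eq0 n_gt1 aP) /(_ i); lia.
Qed.

Lemma surplus_bounded a Z : is_profile n a -> bounded a Z -> surplus n a <= Z ->
  surplus n a <= W.
Proof.
move=> aP [k [kn le [i ai] g]] wZ; apply: (low_surplus (k := k)) wZ => //.
  by apply: (@deficit_gt0I _ i) => //; lia.
by exists i; lia.
Qed.

Lemma settle_bounded a k Z : is_profile n a -> 0 < k < n ->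
  (forall i, n <= a i + k.+1) -> (exists i, a i + k <= n) ->
  good k (capped k a) Z -> surplus n a <= Z ->
  deficit n a + surplus n a <= W + n \/ bounded a Z.
Proof.
move=> aP kn le [i ai] g wZ; have low : exists i, a i + k.-1 <= n by exists i; lia.
have D0 : 0 < deficit n a by apply: (@deficit_gt0I _ i) => //; lia.
case: (normalize aP kn le low g) => [[flat g1]|]; last by right.
left; rewrite addnC leq_add //; last exact: deficit_flat.
by apply: (low_surplus (k := 1)) wZ => //; exists i; lia.
Qed.

(* With Min to move, [surplus + deficit] may exceed the bound by one. *)
Definition inv_max a := deficit n a + surplus n a <= W + n \/
  bounded a (deficit n a + surplus n a).
Definition inv_min a := deficit n a + surplus n a <= (W + n).+1 \/
  bounded a (deficit n a + surplus n a).-1.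

Lemma bounded_shift a s Z : is_profile n a -> bounded a Z -> bounded (shift a s) Z.
Proof.
move=> aP [k [kn le [i ai] g]]; exists k; split=> //.
- by move=> j; exact: le.
- by exists (i + n.-1 * s); have := shift_back n_gt1 s i 0 aP; rewrite !addn0 => ->.
- rewrite (_ : capped k (shift a s) = capped k a) // /capped /shift.
  by apply: (sum_shift n_gt1 (g := fun i => minn k (n - a i))) => j; case: aP => ->.
Qed.

Lemma inv_max_step a j : is_profile n a -> 0 < deficit n a -> inv_max a ->
  playable n a j -> is_profile n (raise n a j) -> inv_min (raise n a j).
Proof.
move=> aP D0 inv jP aP'; have bal := raise_balance n_gt1 a j.
have D' := deficit_raise n_gt1 a j.
have D'' : deficit n (raise n a j) <= deficit n a.
  by apply: leq_sum => i _; apply: leq_sub2l; exact: le_raise.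
case: inv => [h|[k [kn le [i ai] g]]]; first by left; lia.
have up m := le_raise n a j m.
have lowP : exists m, raise n a j m + k <= n.
  by exists i; rewrite /raise; case: (_ == _); lia.
have le' m : n <= raise n a j m + k.+1 by apply: leq_trans (le m) _; rewrite leq_add2r.
have D1 : 0 < deficit n (raise n a j).
  by case: lowP => m hm; apply: (@deficit_gt0I _ m) => //; lia.
suff g' : good k (capped k (raise n a j))
    (deficit n (raise n a j) + surplus n (raise n a j)).-1.
  case: (settle_bounded aP' kn le' lowP g' ltac:(lia)) => h; [left; lia|by right].
(* Chips at or above level [n] and chips on a minimum leave the capped deficit unchanged; only a
   chip in between calls for [good_step]. *)
have cr := capped_raise j k aP; have [h|h] := leqP n (a j).
  have Deq := deficit_raise_ge n_gt1 aP h; rewrite [a j < n]ltnNge h /= addn0 in cr.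
  by rewrite -cr; apply: good_le g _; lia.
have Deq := deficit_raise_lt n_gt1 aP h; rewrite h /= in cr.
have [h2|h2] := leqP n (a j + k); last first.
  by move: cr; rewrite leqNgt h2 addn0 => <-; apply: good_le g _; lia.
rewrite h2 addn1 in cr; rewrite cr in g; have [k0 kn'] := andP kn.
have low2 : exists m, raise n a j m + k.-1 <= n by case: lowP => m; exists m; lia.
apply: (good_step (F := count_ge (raise n a j) n) (w := surplus n (raise n a j)) k0 kn').
- by apply: good_le g _; lia.
- by have := deficit_capped le'; lia.
- exact: surplus_le.
- by apply: capped_le => //; exact: ltnW.
Qed.

Lemma inv_min_step a : is_profile n a -> 0 < deficit n a -> inv_min a ->
  (forall j, playable n a j -> is_profile n (raise n a j)) ->
  exists2 j, playable n a j & inv_max (raise n a j).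
Proof.
move=> aP D0 inv raiseP; have [j jP jmin] := argmin_playable n_gt1 aP.
exists j => //; have aP' := raiseP j jP.
have aj : a j < n by have [i] := deficit_gt0 n_gt1 aP D0; apply: leq_ltn_trans.
have Deq := deficit_raise_lt n_gt1 aP aj; have bal := raise_balance n_gt1 a j.
case: inv => [h|[k [kn le [i ai] g]]]; first by left; lia.
(* The minimum lies just beyond the cap, so Min's chip lowers the deficit but not the capped
   deficit. *)
have aE : a j + k.+1 = n by have := le j; have := jmin i; lia.
have cr := capped_raise j k aP; rewrite aj /= leqNgt (_ : a j + k < n) in cr; last by lia.
rewrite /= addn0 in cr; rewrite cr in g.
have rj : raise n a j j = (a j).+1 by rewrite /raise eqxx addn1.
apply: (settle_bounded aP' kn).
- by move=> m; apply: leq_trans (le m) _; rewrite leq_add2r; exact: le_raise.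
- by exists j; rewrite rj; lia.
- by apply: good_le g _; lia.
- by rewrite leq_addl.
Qed.

Theorem upper_game :
  toppling_number (complete_graph n) <= \sum_(i < n) i + (W + n).+1.
Proof.
rewrite -(deficit_start n_gt1).
apply: (toppling_le n_gt1 (I := inv_max) (J := inv_min)).
- move=> a s aP; rewrite /inv_max deficit_shift // surplus_shift //.
  by case; [left|right; exact: bounded_shift].
- move=> a s aP; rewrite /inv_min deficit_shift // surplus_shift //.
  by case; [left|right; exact: bounded_shift].
(* The initial profile has depth [n - 1] at a single position, so capping at [n - 2] removes just 1
   from the deficit. *)
- right; exists n.-2; split; first by lia.
  + by move=> i; rewrite /start; lia.
  + by exists 0; rewrite /start mod0n; lia.
  have S0 : surplus n (start n) = 0.
    rewrite /surplus big1 // => i _; apply/eqP; rewrite subn_eq0 /start.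
    exact: ltn_pmod.
  have DE := double_sum_ord n; rewrite S0 addn0 (deficit_start n_gt1).
  apply: good_start => //.
  rewrite -DE; suff -> : \sum_(i < n) i = capped n.-2 (start n) + 1 by lia.
  rewrite -(deficit_start n_gt1) /deficit /capped.
  rewrite (bigD1 (Ordinal n_gt0)) //= [X in _ = X + 1](bigD1 (Ordinal n_gt0)) //=.
  rewrite /start mod0n (_ : minn _ _ = n.-2); last by lia.
  rewrite [in RHS]addnAC; congr (_ + _); first by lia.
  apply: eq_bigr => i; rewrite -val_eqE /= => i0.
  by rewrite modn_small //; have := ltn_ord i; lia.
- move=> a j aP D0 inv jP; apply: inv_max_step => //.
  exact: raise_is_profile.
- move=> a aP D0 inv; apply: inv_min_step => // j jP.
  exact: raise_is_profile.
- move=> a aP; case=> [[h|h]|[h|h]].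
  + lia.
  + have := surplus_bounded aP h (leq_addl _ _); lia.
  + lia.
  + have [k [/andP [k0 kn] le [i ai] g]] := h.
    have D1 : 0 < deficit n a by apply: (@deficit_gt0I _ i) => //; lia.
    have := surplus_bounded aP h ltac:(lia); lia.
Qed.
End Game.
End UpperBound.

End Cycle.

(** * Rescaling by [n] and comparison with the curves *)

Module Estimates.
Import Curves Cycle.
Import Lra Psatz all_boot zify.
Set Implicit Arguments.
Unset Strict Implicit.
Unset Printing Implicit Defensive.
Local Open Scope R_scope.

Section NatReal.

Lemma leq_INR m n : (m <= n)%N -> INR m <= INR n.
Proof. by move/leP; exact: le_INR. Qed.

Lemma INR_addn m n : INR (m + n)%N = INR m + INR n.
Proof. exact: plus_INR. Qed.

Lemma INR_muln m n : INR (m * n)%N = INR m * INR n.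
Proof. exact: mult_INR. Qed.

Lemma INR_predn n : (0 < n)%N -> INR n.-1 = INR n - 1.
Proof. by case: n => // n _; rewrite S_INR /=; lra. Qed.

Definition INR_norm := (INR_addn, INR_muln, S_INR).

Lemma nat_between (x : R) : 0 <= x -> exists m, x < INR m <= x + 1.
Proof.
move=> x0; have [u1 u2] := archimed x.
have : (0 <= up x)%Z by apply: le_IZR; lra.
move/IZN => [m mE]; rewrite mE -INR_IZR_INZ in u1 u2; exists m.
by split; lra.
Qed.

Lemma INR_sum_ord n : 2 * INR (\sum_(i < n) i) = INR n * (INR n - 1).
Proof.
case: n => [|n]; first by rewrite big_ord0 /=; lra.
by have := congr1 INR (double_sum_ord n.+1); rewrite !INR_norm /=; lra.
Qed.
End NatReal.

Section UpperAnalysis.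
Variables (zeta c : R -> R) (L B : R).
Hypothesis zeta_decr : forall x y, x <= y -> zeta y <= zeta x.
Hypothesis zeta_slope : forall x y, x <= y -> zeta x - zeta y <= 2 * c x * (y - x).
Hypothesis zeta_static : forall x k, 0 <= x -> 0 <= k -> k < c x ->
  (1 - x) * k - k * k / 2 + x * x / 2 <= zeta x.
Hypothesis c01 : forall x, 0 <= c x <= 1.
Hypothesis zeta_neg : forall x, x <= 0 -> c x = c 0 /\ zeta x = zeta 0.
Hypothesis zeta0 : 1 / 2 <= zeta 0.
Hypothesis LB : L * L / 2 <= B.
Hypothesis zeta_end : forall x, L <= x -> zeta x <= B.

(* If the profile has [m] entries [>= n] and falls to depth [k] on a plateau,
   the capped deficit is [E = (n - m) k - k ^ 2 / 2], and [width] recovers [m];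
   otherwise it exceeds [m]. *)
Definition width (N k E : R) : R := N - k / 2 - E / k.

Lemma width_step N k E : k <> 0 -> width N k E = width N k (E + 1) + / k.
Proof. by move=> k0; rewrite /width; field. Qed.

(** For [F >= 1] this follows from [F * F - F <= (F - 1 / 2) ^ 2] and [0 < F - 1 / 2 <= K]. *)
Lemma surplus_width F K w : F = 0 \/ 1 <= F ->
  2 * w + F <= F * F -> F <= K + / 2 -> w <= K * K / 2.
Proof. by move=> F01 hw hF; case: F01 => h; nra. Qed.

(** If [c x <= k / N], the width grows by [1 / k] and the rescaled value drops by at most 2, like
    [Z]. Otherwise [Z <= E + N + w] already lies below the curve, by [zeta_static]. *)
Lemma value_step N k E Z F w : 1 <= N -> 1 <= k -> k <= N -> 0 <= F ->
  F = 0 \/ 1 <= F -> 0 <= E -> 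
  Z + 2 <= N * N * zeta (width N k (E + 1) / N) + 8 * N ->
  Z <= E + N + w -> 2 * w + F <= F * F ->
  2 * E + 2 * k * F + k * (k - 1) <= 2 * k * N ->
  Z <= N * N * zeta (width N k E / N) + 8 * N.
Proof.
move=> N1 k1 kN F0 F01 E0 hZ hE hw hF.
have k'0 : 0 < / k <= 1.
  by split; [apply: Rinv_0_lt_compat; lra|rewrite -Rinv_1; apply: Rinv_le_contravar; lra].
have N'0 : 0 < / N by apply: Rinv_0_lt_compat; lra.
have NN' : N * / N = 1 by rewrite Rinv_r; lra.
have := @width_step N k E ltac:(lra).
set x := width N k (E + 1) / N in hZ *; set y := width N k E / N.
have kE : k * (E / k) = E by field; lra.
have wd : F <= width N k E + / 2 by rewrite /width; nra.
have wN : width N k E <= N.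
  rewrite /width; have : 0 <= E / k by apply: Rmult_le_pos; lra.
  lra.
have yE : width N k E = N * y by rewrite /y; field; lra.
have xE : width N k (E + 1) = N * x by rewrite /x; field; lra.
have EE : E = (N - N * y) * k - k * k / 2 by rewrite -yE /width; field; lra.
rewrite xE yE => yx; rewrite yE in wd wN.
have hw2 := @surplus_width F (N * y) w F01 hw wd.
have y1 : y <= 1 by nra.
have xy : x <= y by nra.
have dxy : N * (y - x) = / k by lra.
have sl := zeta_slope xy.
have slN : N * N * (zeta x - zeta y) <= 2 * c x * (N * / k).
  rewrite -dxy; have := Rmult_le_compat_l (N * N) _ _ ltac:(nra) sl; lra.
have cx := c01 x.
case: (Rle_lt_dec (c x) (k / N)) => ck.
  suff : c x * (N * / k) <= 1 by lra.
  have -> : 1 = k / N * (N * / k) by field; lra.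
  apply: Rmult_le_compat_r => //; nra.
(* The width can be slightly negative; [zeta_static] is then applied at 0, with an error linear in
   [N]. *)
have x_low : - 3 / 2 <= N * x by lra.
set kap := k / N in ck.
have kapE : k = N * kap by rewrite /kap; field; lra.
have kap0 : 0 <= kap by apply: Rmult_le_pos; lra.
have stat : N * N * ((1 - x) * kap - kap * kap / 2 + x * x / 2) <=
    N * N * zeta x + 3 * N.
  case: (Rle_lt_dec 0 x) => x0.
    have := Rmult_le_compat_l (N * N) _ _ ltac:(nra) (zeta_static x0 kap0 ck); lra.
  have [cE zE] := zeta_neg (Rlt_le _ _ x0); rewrite cE in ck.
  have := Rmult_le_compat_l (N * N) _ _ ltac:(nra) (zeta_static (Rle_refl 0) kap0 ck).
  rewrite zE; set q := zeta 0; move: (x_low); set p := N * x => hp hq.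
  have -> : N * N * ((1 - x) * kap - kap * kap / 2 + x * x / 2) =
    N * N * ((1 - 0) * kap - kap * kap / 2 + 0 * 0 / 2) - p * (N * kap) + p * p / 2.
    by rewrite /p; field.
  have p0 : p < 0 by rewrite /p; nra.
  have kk : 0 <= N * kap <= N by rewrite -kapE; lra.
  have : - p * (N * kap) <= 3 / 2 * N by nra.
  have : p * p <= 9 / 4 by nra.
  nra.
have Nk : N * / k <= N by nra.
have : N * N * (zeta x - zeta y) <= 2 * N.
  have : c x * (N * / k) <= 1 * N by apply: Rmult_le_compat; nra.
  lra.
have : N * N * ((1 - y) * kap - kap * kap / 2 + y * y / 2) <=
   N * N * ((1 - x) * kap - kap * kap / 2 + x * x / 2) + N.
  have -> : N * N * ((1 - y) * kap - kap * kap / 2 + y * y / 2) =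
   N * N * ((1 - x) * kap - kap * kap / 2 + x * x / 2) +
     N * (N * (y - x)) * ((y + x) / 2 - kap) by field.
  rewrite dxy; have : (y + x) / 2 - kap <= 1 by lra.
  have : 0 <= N * / k by nra.
  nra.
rewrite EE kapE in hE; nra.
Qed.

Lemma upper_bound_at n W : (2 < n)%N ->
  B * (INR n * INR n) + 9 * INR n <= INR W ->
  (toppling_number (complete_graph n) <= \sum_(i < n) i + (W + n).+1)%N.
Proof.
move=> n2 hW; set N := INR n in hW.
have N3 : 3 <= N by have := leq_INR n2; rewrite /N /=; lra.
pose good k E Z := INR Z <= N * N * zeta (width N (INR k) (INR E) / N) + 8 * N.
have kR k : (0 < k)%N -> 1 <= INR k by move/leq_INR.
have F01 F : INR F = 0 \/ 1 <= INR F by case: F => [|F]; [left|right; exact: kR].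
have E0 E : 0 <= INR E := pos_INR E.
apply: (@upper_game n _ good).
- exact: ltnW.
- by [].
- by move=> k E Z Z' hZ /leq_INR; rewrite /good in hZ *; lra.
- move=> k E q Z k1 hZ; move/leq_INR; rewrite !INR_norm INR_predn ?(ltnW k1) //= => hE.
  have k2 : 2 <= INR k by have := leq_INR k1; rewrite /=; lra.
  apply: Rle_trans hZ _; apply: Rplus_le_compat_r; apply: Rmult_le_compat_l; first by nra.
  apply: zeta_decr; apply: Rmult_le_compat_r.
    by apply: Rlt_le; apply: Rinv_0_lt_compat; lra.
  rewrite INR_predn ?(ltnW k1) // /width INR_addn.
  move: hE; set K := INR k in k2 *; move: (INR E) (INR q) => e s hE.
  suff : 0 <= e / (K - 1) - (e + s) / K - 1 / 2 by lra.
  have -> : e / (K - 1) - (e + s) / K - 1 / 2 =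
    (2 * (e + s) - 2 * K * s - K * (K - 1)) / (2 * (K * (K - 1))) by field; lra.
  by apply: Rmult_le_pos; [lra|apply: Rlt_le; apply: Rinv_0_lt_compat; nra].
- move=> k E F Z w k0 kn hZ /leq_INR h1 /leq_INR h2 /leq_INR h3.
  rewrite /good in hZ *; rewrite !INR_norm in hZ h1 h2.
  rewrite !INR_norm INR_predn //= in h3.
  apply: (@value_step _ _ _ _ (INR F) (INR w)) => //; try lra.
  + exact: kR.
  + by apply: leq_INR; apply: ltnW.
  + by move: h2; rewrite /=; lra.
  + by rewrite -/N in h3; lra.
- move=> k E F Z w k0 kn hZ /leq_INR hw /leq_INR h2 /leq_INR h3.
  rewrite !INR_norm /= in h2; rewrite !INR_norm INR_predn //= in h3.
  apply/leP; apply: INR_le; rewrite /good in hZ.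
  set K := INR k in hZ h3; set x := width N K (INR E) / N in hZ.
  have K1 : 1 <= K := kR _ k0.
  (* Beyond [L] the value itself is at most [B]; before [L] the small width bounds the surplus. *)
  case: (Rle_lt_dec L x) => xL; first by have := zeta_end xL; nra.
  have xE : width N K (INR E) = N * x by rewrite /x; field; lra.
  have wd : INR F <= N * x + / 2.
    have eE : INR E = K * (INR E / K) by field; lra.
    rewrite -/N in h3; rewrite -xE /width; apply: (Rmult_le_reg_l K); lra.
  have := @surplus_width (INR F) (N * x) (INR w) (F01 F) ltac:(lra) wd.
  have B0 : 0 <= B by nra.
  have NB : 0 <= N * N * B by apply: Rmult_le_pos; nra.
  case: (Rle_lt_dec 0 x) => x0.
    have : (N * x) * (N * x) <= (N * N) * (L * L).
      rewrite (_ : N * x * (N * x) = (N * N) * (x * x)); last by ring.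
      by apply: Rmult_le_compat_l; nra.
    have := Rmult_le_compat_l (N * N) _ _ ltac:(nra) LB; lra.
  have := pos_INR F => F0; have p0 : N * x < 0 by nra.
  have : (N * x) * (N * x) <= / 4 by move: (N * x) p0 wd => p p0 wd; nra.
  lra.
- move=> E Z /(congr1 INR); rewrite !INR_norm INR_predn ?(ltnW (ltnW n2)) //= -/N => hE.
  move/(congr1 INR); rewrite !INR_norm INR_predn ?(ltnW (ltnW n2)) //= -/N => hZ.
  rewrite /good !INR_predn -/N; [|lia|lia].
  have -> : width N (N - 1 - 1) (INR E) / N = / (2 * N).
    rewrite /width; have -> : INR E = (N * (N - 1) - 2) / 2 by lra.
    by field; lra.
  have N'0 : 0 <= / (2 * N) by apply: Rlt_le; apply: Rinv_0_lt_compat; lra.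
  have := zeta_slope N'0; have [] := c01 0; set q := zeta (/ _) => c0 c1 h.
  have : N * N * (/ (2 * N)) = N / 2 by field; lra.
  nra.
Qed.

End UpperAnalysis.

Theorem toppling_upper : exists N, forall n, (N <= n)%N ->
  (INR (toppling_number (complete_graph n)) < 0.637152 * (INR n * INR n))%R.
Proof.
have [zeta [c [H1 [H2 [H3 [H4 [H5 [H6 [L [H7 H8]]]]]]]]]] := upper_curve.
(* The margin [0.637152 - 0.5 - 0.13715193] is 0.00000007, which at this size exceeds the terms
   linear in [n]. *)
have [N [hN _]] := @nat_between 1000000000%R ltac:(lra).
exists (maxn N 3) => n; rewrite geq_max => /andP [/leq_INR nN n2].
have [W [hW1 hW2]] := @nat_between (0.13715193 * (INR n * INR n) + 9 * INR n) ltac:(nra).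
have /leq_INR := upper_bound_at H1 H2 H3 H4 H5 H6 H7 H8 n2 (Rlt_le _ _ hW1).
have := INR_sum_ord n; rewrite !INR_norm; nra.
Qed.

(** * The lower bound: from the curve to the budget of the game *)

Definition descent (d p : R -> R) (x y : R) : Prop :=
  0 <= d x - d y /\
  ((y - x) * (2 * p y + x + slack) <= d x - d y /\ p x - p y <= 6000 * (y - x)
   \/ 0.0000005 <= d x - d y).

Definition priced (dx px x : R) : Prop :=
  0.0001 <= 1 - x - px /\ (1 - x) / 2 <= px /\
    dx = (1 - x) * (1 - x) / 2 - (1 - x - px) * (1 - x - px) \/
  0.0003 <= px /\ px <= (1 - x) / 2 /\ dx = px * px.

(** The arc and the spiral are glued at [switch]. The deficit drops there by a constant, and this is
    the second alternative of [descent]; in units of chips the drop is quadratic and pays for any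
    single extension. *)
Lemma lower_curve : exists d p : R -> R,
  [/\ d 0 <= 1 / 2 - 0.00000001,
      forall x, 0 <= x <= final -> 0 < d x,
      forall x y, 0 <= x -> x <= y -> y <= final -> descent d p x y
    & forall x, 0 <= x <= final -> priced (d x) (p x) x].
Proof.
have [d1 [p1 [pot1 P1]]] := early_curve; have [d2 [p2 [pot2 P2]]] := late_curve.
have swE : switch = 0.278464 by []; have fE : final = 0.43909 by [].
have slE : slack = 0.0000001 by [].
exists (fun x => if Rlt_dec x switch then d1 x else d2 x),
  (fun x => if Rlt_dec x switch then p1 x else p2 x); split.
- case: (Rlt_dec 0 switch) => [h|] /=; last by lra.
  by have [h1 [h2 h3]] := P1 0 ltac:(lra); rewrite h3; nra.
- move=> x hx; case: (Rlt_dec x switch) => xs /=.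
    by have [h1 [h2 h3]] := P1 x ltac:(lra); rewrite h3; nra.
  by have [h1 [h2 h3]] := P2 x ltac:(lra); rewrite h3; nra.
- move=> x y x0 xy yf; rewrite /descent; case: (Rlt_dec x switch) => xs;
  case: (Rlt_dec y switch) => ys /=; last 1 first.
  + have [h1 h2] := pot2 x y ltac:(lra) xy yf; split; last by left.
    have [h3 _] := P2 y ltac:(lra); nra.
  + have [h1 h2] := pot1 x y x0 xy ltac:(lra); split; last by left.
    have [h3 [h4 _]] := P1 y ltac:(lra); nra.
  + have [h1 _] := pot1 x switch x0 ltac:(lra) ltac:(lra).
    have [h2 _] := pot2 switch y ltac:(lra) ltac:(lra) yf.
    have [h3 [h4 h5]] := P1 switch ltac:(lra).
    have [h6 [h7 h8]] := P2 switch ltac:(lra); have [h9 _] := P2 y ltac:(lra).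
    have g1 : 0 <= d1 x - d1 switch by nra.
    have g2 : 0 <= d2 switch - d2 y by nra.
    have g3 : 0.0000005 <= d1 switch - d2 switch.
      have : (1 - switch - p1 switch) * (1 - switch - p1 switch) <= 0.360768 * 0.360768.
        by apply: Rmult_le_compat; lra.
      have : p2 switch * p2 switch <= 0.360767 * 0.360767 by apply: Rmult_le_compat; lra.
      rewrite h5 h8 swE; lra.
    by split; [lra|right; lra].
  + lra.
- move=> x hx; rewrite /priced; case: (Rlt_dec x switch) => xs /=.
    by left; apply: P1; lra.
  by right; have [h1 [h2 h3]] := P2 x ltac:(lra); do 2?split; lra.
Qed.

(** The price bounds are quadratic, with base [N (1 - x - px)] or [N px], at least [0.0001 N]. An
    excess of [3 N] in [D] therefore shifts the price by a bounded amount only. *)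
Lemma price_le (N x dx px D v : R) : 1000000000000 <= N -> 0 <= x <= final ->
  priced dx px x -> 0 <= v <= N * (1 - x) -> D <= N * N * dx + 3 * N ->
  (2 * v <= N * (1 - x) -> v * v <= D) ->
  (N * (1 - x) <= 2 * v -> (N * (1 - x)) * (N * (1 - x)) <=
     2 * D + 2 * ((N * (1 - x) - v) * (N * (1 - x) - v))) ->
  v <= N * px + 20000.
Proof.
have fE : final = 0.43909 by []; set g := N * (1 - x) => N0 hx pr hv hD h1 h2.
have g0 : 0.56 * N <= g by rewrite /g; nra.
have gE : N * N * ((1 - x) * (1 - x)) = g * g by rewrite /g; ring.
case: (Rle_lt_dec v (N * px + 20000)) => // lt; exfalso.
case: pr => [[r1 [r2 e]]|[r1 [r2 e]]].
  have gp : g / 2 <= N * px by rewrite /g; nra.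
  have := h2 ltac:(lra); set m := N * (1 - x - px) => h.
  have mE : m = g - N * px by rewrite /m /g; ring.
  have m0 : N <= 10000 * m by rewrite /m; nra.
  have De : N * N * dx = g * g / 2 - m * m by rewrite e /m /g; field.
  have : 0 <= g - v by lra.
  have : g - v <= m - 20000 by lra.
  nra.
have De : N * N * dx = (N * px) * (N * px) by rewrite e; ring.
have gp : N * px <= g / 2 by rewrite /g; nra.
have a0 : 0.0003 * N <= N * px by nra.
move: (N * px) De gp a0 lt => a De gp a0 lt.
case: (Rle_lt_dec (2 * v) g) => vg; first by have := h1 vg; nra.
have := h2 ltac:(lra); nra.
Qed.

Lemma lower_step (d p : R -> R) (N l D v : R) : 1000000000000 <= N -> 0 <= l ->
  (l + 1) / N <= final ->
  descent d p (l / N) ((l + 1) / N) -> priced (d (l / N)) (p (l / N)) (l / N) ->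
  0 <= v <= N - l -> N * N * d (l / N) <= D ->
  (2 * v <= N - l -> v * v <= D) ->
  (N - l <= 2 * v -> (N - l) * (N - l) <= 2 * D + 2 * ((N - l - v) * (N - l - v))) ->
  2 * v + l + N * N * d ((l + 1) / N) <= D.
Proof.
move=> N0 l0 yf de pr hv hD h1 h2.
have xE : l = N * (l / N) by field; lra.
have yE : (l + 1) / N - l / N = / N by field; lra.
have N'0 : 0 < / N by apply: Rinv_0_lt_compat; lra.
have x0 : 0 <= l / N by apply: Rmult_le_pos; lra.
have NN : N * / N = 1 by rewrite Rinv_r; lra.
move: de pr hD yf x0 yE; set x := l / N in xE *; set y := (l + 1) / N.
case=> de0 de pr hD yf x0 yE.
have dN : 0 <= N * N * (d x - d y) by apply: Rmult_le_pos; nra.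
(* An excess of [3 N] pays for any extension, as [2 v + l <= 2 N]. *)
case: (Rle_lt_dec (N * N * d x + 3 * N) D) => DN; first by lra.
case: de => [[de pL]|jump]; last first.
  have : N * N * 0.0000005 <= N * N * (d x - d y) by apply: Rmult_le_compat_l; nra.
  nra.
have gE : N * (1 - x) = N - l by lra.
have vp := @price_le N x (d x) (p x) D v N0 ltac:(lra) pr.
rewrite gE in vp; have {}vp := vp hv ltac:(lra) h1 h2.
rewrite yE in de pL.
have : N * N * (/ N * (2 * p y + x + slack)) <= N * N * (d x - d y).
  by apply: Rmult_le_compat_l; nra.
have -> : N * N * (/ N * (2 * p y + x + slack)) = 2 * (N * p y) + l + N * slack.
  by rewrite (_ : forall q, N * N * (/ N * q) = N * q); [lra|move=> q; field; lra].
have : N * p x <= N * p y + 6000.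
  have := Rmult_le_compat_l N _ _ ltac:(lra) pL; nra.
(* [N * slack] is at least 100000, while the price errors amount to [2 * (20000 + 6000)]. *)
rewrite /slack; lra.
Qed.

Theorem toppling_lower : exists N, forall n, (N <= n)%N ->
  0.596400 * (INR n * INR n) < INR (toppling_number (complete_graph n)).
Proof.
have [d [p [d0 dpos dd pr]]] := lower_curve.
have fE : final = 0.43909 by [].
have [N0 [hN _]] := @nat_between 1000000000000 ltac:(lra).
exists (maxn N0 2) => n; rewrite geq_max => /andP [/leq_INR nN n2].
set N := INR n in nN *; have N12 : 1000000000000 < N by lra.
(* The goal [m - 1] exceeds [final * N - 1], and [final ^ 2 / 2] exceeds 0.0964 by more than
   0.00000001. *)
have [m [hm1 hm2]] := @nat_between (final * N) ltac:(nra).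
have m1 : (1 < m)%N by rewrite ltnNge; apply/negP => /leq_INR /=; nra.
have lastE := INR_predn (ltnW m1).
have xle l : (l <= m.-1)%N -> 0 <= INR l / N <= final.
  move=> /leq_INR lm; have N'0 : 0 < / N by apply: Rinv_0_lt_compat; lra.
  have l0 := pos_INR l; split; first by apply: Rmult_le_pos; lra.
  apply: (Rmult_le_reg_r N); first lra.
  by rewrite (_ : INR l / N * N = INR l); [lra|field; lra].
have mn : (m.-1 <= n)%N.
  by apply/leP; apply: INR_le; rewrite lastE -/N; rewrite fE in hm2; lra.
suff : (\sum_(i < n) i + \sum_(i < m.-1) i <= toppling_number (complete_graph n))%N.
  move/leq_INR; rewrite INR_addn.
  have := INR_sum_ord n; have := INR_sum_ord m.-1; rewrite lastE -/N.
  have : (0.43909 * N - 1) * (0.43909 * N - 2) <= (INR m - 1) * (INR m - 1 - 1).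
    by rewrite fE in hm1; apply: Rmult_le_compat; lra.
  have : 1000000000000 * N <= N * N by apply: Rmult_le_compat_r; lra.
  lra.
(* Before the goal the required deficit is read off the curve. As [d] stays positive up to [final],
   a vanishing deficit means that the goal is reached. *)
apply: (@lower_game n n2 m.-1
  (fun l D => (m.-1 <= l)%N \/ N * N * d (INR l / N) <= INR D)).
- exact: mn.
- move=> l D D' [h|h] DD'; [by left|right; apply: Rle_trans h _; exact: leq_INR].
(* The initial deficit is [N * N / 2 - N / 2]; the late start of the arc makes room for the linear
   term. *)
- right; rewrite deficit_start //.
  have h1 := xle 1%N ltac:(lia); have [h _] := dd 0 (INR 1 / N) ltac:(lra) (proj1 h1) (proj2 h1).
  move: h; set q := d (INR 1 / N) => h.
  have := INR_sum_ord n; rewrite -/N => hs.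
  have : N * N * q <= N * N * (1 / 2 - 0.00000001) by apply: Rmult_le_compat_l; nra.
  have : 1000000000000 * N <= N * N by apply: Rmult_le_compat_r; lra.
  lra.
- move=> l [//|h]; rewrite leqNgt; apply/negP => lm.
  have dl := dpos _ (xle l (ltnW lm)); move: h => /=.
  by have := Rmult_lt_0_compat (N * N) _ ltac:(nra) dl; lra.
- move=> l D v l0 lm vl [B1 B2] [h|h]; first by lia.
  have hl := leq_INR (ltnW lm).
  have ln : (l <= n)%N by lia.
  have st := @lower_step d p N (INR l) (INR D) (INR v) ltac:(lra) (pos_INR l).
  have hy := xle l.+1 lm; rewrite S_INR in hy.
  have hl2 := xle l (ltnW lm).
  have xy : INR l / N <= (INR l + 1) / N.
    by apply: Rmult_le_compat_r; [apply: Rlt_le; apply: Rinv_0_lt_compat; lra|lra].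
  have g : INR (n - l)%N = N - INR l by rewrite minus_INR //; apply/leP.
  have {}st : 2 * INR v + INR l + N * N * d ((INR l + 1) / N) <= INR D.
    apply: st => //; try lra.
    + by apply: dd; lra.
    + by apply: pr; lra.
    + by split; [exact: pos_INR|rewrite -g; exact: leq_INR].
    + move=> hv; rewrite -INR_muln; apply: leq_INR; apply: B1.
      by apply/leP; apply: INR_le; rewrite g -addnn INR_addn; lra.
    + rewrite -g => hv; have vl' := leq_INR vl.
      have : (n - l <= v.*2)%N by apply/leP; apply: INR_le; rewrite -addnn INR_addn; lra.
      have g2 : INR (n - l - v)%N = N - INR l - INR v by rewrite minus_INR ?g //; apply/leP.
      by move/B2 => /leq_INR; rewrite !INR_norm /= g2 g; lra.
  have dy := dpos _ hy.
  have Dv : (2 * v + l <= D)%N.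
    by apply/leP; apply: INR_le; rewrite !INR_norm /=; nra.
  split=> //; right; rewrite minus_INR; last by apply/leP.
  by rewrite !INR_norm /=; lra.
Qed.

End Estimates.

Local Open Scope R_scope.

Theorem theorem1p1 :
  exists N : nat, forall n : nat, (N <= n)%nat ->
    0.596400 * INR n ^ 2 < INR (toppling_number (complete_graph n))
      < 0.637152 * INR n ^ 2.
Proof.
destruct Estimates.toppling_lower as [N1 lower].
destruct Estimates.toppling_upper as [N2 upper].
exists (Nat.max N1 N2); intros n hn.
replace (INR n ^ 2) with (INR n * INR n) by (simpl; ring).
split.
  apply lower; apply (ssrbool.introT ssrnat.leP).
  exact (Nat.max_lub_l _ _ _ hn).
apply upper; apply (ssrbool.introT ssrnat.leP).
exact (Nat.max_lub_r _ _ _ hn).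
Qed.
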